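(* Let $X$ be a complex Banach space and let $T\in\mathcal{B}(X)$ be a power-bounded operator such that $\sigma(T)\cap\mathbb{T}=\{1\}$. Let $m:(0,\pi]\to(0,\infty)$ be a continuous decreasing function such that $\|R(\mathrm{e}^{\mathrm{i}\theta},T)\|\leq m(|\theta|)$ for all $\theta$ with $0<|\theta|\leq\pi$, and define $m_{\log}:(0,\pi]\to(0,\infty)$ by $$m_{\log}(\theta):=m(\theta)\log\left(1+\frac{m(\theta)}{\theta}\right).$$ Then, for any $c\in(0,1)$, $\|T^n(I-T)\|=O\big(m_{\log}^{-1}(cn)\big)$ as $n\to\infty$.
   Context: $T$ is power-bounded if $\sup_{n\geq0}\|T^n\|<\infty$; $\mathbb{T}$ is the unit circle; $R(\lambda,T)=(\lambda-T)^{-1}$. The function $m_{\log}$ is strictly decreasing and $m_{\log}^{-1}$ denotes its inverse, defined on the range of $m_{\log}$. *)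

(* Defs.v *)
From mathcomp Require Import all_boot all_algebra.
From mathcomp Require Import all_classical all_reals all_analysis.
From mathcomp Require Import complex.
Import GRing.Theory Num.Theory.
Import numFieldNormedType.Exports.
Set Implicit Arguments. Unset Strict Implicit. Unset Printing Implicit Defensive.
Local Open Scope ring_scope.
Local Open Scope complex_scope.
Local Open Scope classical_set_scope.

(* Complex Banach spaces are modelled as [V : completeNormedModType R[i]]
   with [R : realType]; norms [`|x|] take (real) values in [R[i]]. *)

Definition op_norm_le (R : realType) (V : normedModType R[i]) (A : V -> V) (M : R) : Prop :=
  forall x : V, `|A x| <= M%:C * `|x|.

Definition power_bounded (R : realType) (V : normedModType R[i]) (T : V -> V) : Prop :=
  exists M : R, forall (n : nat) (x : V), `|iter n T x| <= M%:C * `|x|.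

Definition is_inverse (R : realType) (V : normedModType R[i]) (S A : V -> V) : Prop :=
  (forall x, S (A x) = x) /\ (forall x, A (S x) = x).

Definition shift_op (R : realType) (V : normedModType R[i]) (l : R[i]) (T : V -> V) : V -> V :=
  fun x => l *: x - T x.

Definition in_resolvent_set (R : realType) (V : normedModType R[i]) (T : V -> V) (l : R[i]) : Prop :=
  exists S : {linear V -> V}, continuous S /\ is_inverse S (shift_op l T).

Definition spectrum (R : realType) (V : normedModType R[i]) (T : V -> V) : set R[i] :=
  [set l | ~ in_resolvent_set T l].

Definition unit_circle (R : realType) : set R[i] := [set z | `|z| = 1].

Definition expi (R : realType) (t : R) : R[i] := cos t +i* sin t.

Definition m_log (R : realType) (m : R -> R) (t : R) : R :=
  m t * ln (1 + m t / t).

(* Main.v *)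
(* Let t be given by m_log t = c n and let mu = m t, so that |R(l,T)| <= mu on the
   arc |arg l| >= t.  The symbol l - 1 of T - 1 is split as W_low + W_high, both
   continuous and piecewise affine in l, with W_low supported in |arg l| <= 2 t'
   and W_high in |arg l| >= t', where t' is comparable to t and divides pi.
   - The Fourier coefficients of W_low are O(min(t^2, 1/j^2)), hence have l^1-norm
     O(t), and power-boundedness makes the low part of T^n (T - 1) be O(t).
   - The high part is (2 i pi)^-1 times the integral of l^n R(l,T) W_high(l).
     Integrating by parts kappa = floor(c n / mu) times bounds it by
     O(1/n) (from the corners of W_high) plus
     O(mu kappa! (mu/n)^kappa) = O(mu exp(-c n / mu)) = O(t).
   Finally mu >= 1/t because 1 is in the spectrum, so that 1/n <= 1/mu <= t.
   Integrals are replaced by Riemann sums over the (p L)-th roots of unity, with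
   L = pi / t' * 2 fixed and p going to infinity; the sums for the frequencies n
   and n - k are related exactly by l R(l,T) = T R(l,T) + 1. *)
Require Import Defs.
From HB Require Import structures.
From mathcomp Require Import all_boot all_order all_algebra.
From mathcomp Require Import all_classical all_reals all_analysis.
From mathcomp Require Import complex ring lra zify.
Import Order.TTheory GRing.Theory Num.Theory.
Import numFieldNormedType.Exports.
Set Implicit Arguments.
Unset Strict Implicit.
Unset Printing Implicit Defensive.
Local Open Scope ring_scope.
Local Open Scope complex_scope.
Local Open Scope classical_set_scope.

(** * Norms with values in the real field *)

Section RealNorm.
Variable R : realType.

(** The norm of a complex space takes values in [R[i]]; its real part lives in the totally ordered
    field [R], where order arguments and [lra] apply. *)
Definition nr (Z : normedZmodType R[i]) (x : Z) : R := complex.Re `|x|.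

Section Zmod.
Variable Z : normedZmodType R[i].
Implicit Types x y : Z.

Lemma nrE x : (nr x)%:C = `|x|.
Proof. by rewrite /nr RRe_real // normr_real. Qed.

Lemma nr_ge0 x : 0 <= nr x.
Proof. by rewrite -lecR nrE; exact: normr_ge0. Qed.

Lemma nr0 : nr (0 : Z) = 0.
Proof. by apply: complexI; rewrite nrE normr0. Qed.

Lemma nr_eq0 x : nr x = 0 -> x = 0.
Proof. by move=> h; apply/normr0_eq0; rewrite -nrE h. Qed.

Lemma nrN x : nr (- x) = nr x.
Proof. by apply: complexI; rewrite !nrE normrN. Qed.

Lemma nrD x y : nr (x + y) <= nr x + nr y.
Proof. by rewrite -lecR rmorphD /= !nrE ler_normD. Qed.

Lemma nrB x y : nr (x - y) <= nr x + nr y.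
Proof. by rewrite -(nrN y) nrD. Qed.

Lemma nrBC x y : nr (x - y) = nr (y - x).
Proof. by rewrite -nrN opprB. Qed.

Lemma nrB_trans y x z : nr (x - z) <= nr (x - y) + nr (y - z).
Proof. by have := nrD (x - y) (y - z); rewrite addrA subrK. Qed.

Lemma nr_sum (I : Type) (r : seq I) (P : pred I) (F : I -> Z) :
  nr (\sum_(i <- r | P i) F i) <= \sum_(i <- r | P i) nr (F i).
Proof.
elim/big_ind2: _ => [|x1 x2 y1 y2 h1 h2|//]; first by rewrite nr0.
exact: le_trans (nrD _ _) (lerD h1 h2).
Qed.

End Zmod.

Lemma nr1 : nr (1 : R[i]) = 1.
Proof. by apply: complexI; rewrite nrE normr1. Qed.

Lemma nrM (a b : R[i]) : nr (a * b) = nr a * nr b.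
Proof. by apply: complexI; rewrite rmorphM /= !nrE normrM. Qed.

Lemma nrV (a : R[i]) : nr a^-1 = (nr a)^-1.
Proof. by apply: complexI; rewrite fmorphV /= !nrE normfV. Qed.

Lemma nrX (a : R[i]) n : nr (a ^+ n) = nr a ^+ n.
Proof. by apply: complexI; rewrite rmorphXn /= !nrE normrX. Qed.

Lemma nrXz (a : R[i]) (z : int) : nr a = 1 -> nr (a ^ z) = 1.
Proof.
by move=> h; case: z => n; rewrite /exprz ?nrV nrX h expr1n ?invr1.
Qed.

Lemma nrZ (V : normedModType R[i]) (a : R[i]) (x : V) :
  nr (a *: x) = nr a * nr x.
Proof. by apply: complexI; rewrite rmorphM /= !nrE normrZ. Qed.

Lemma nr_nat (n : nat) : nr (n%:R : R[i]) = n%:R.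
Proof. by apply: complexI; rewrite nrE normr_nat rmorph_nat. Qed.

Lemma nr_int (z : int) : nr (z%:~R : R[i]) = `|z|%:~R.
Proof. by apply: complexI; rewrite nrE -intr_norm rmorph_int. Qed.

Lemma op_norm_leP (V : normedModType R[i]) (A : V -> V) (M : R) :
  op_norm_le A M <-> forall x, nr (A x) <= M * nr x.
Proof.
by split=> h x; have := h x; rewrite -!nrE -rmorphM /= lecR.
Qed.

End RealNorm.

(** * The parametrisation of the unit circle *)

Section Expi.
Variable R : realType.
Implicit Types s t : R.

Lemma expi0 : expi (0 : R) = 1.
Proof. by rewrite /expi cos0 sin0. Qed.

Lemma expiD s t : expi (s + t) = expi s * expi t.
Proof.
rewrite /expi cosD sinD; apply/eqP.
rewrite eq_complex /=; apply/andP; split; apply/eqP; ring.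
Qed.

Lemma nr_expi t : nr (expi t) = 1.
Proof. by apply: complexI; rewrite nrE normc_def /= cos2Dsin2 sqrtr1. Qed.

Lemma expi_neq0 t : expi t != 0.
Proof. by apply: contra_eq_neq (nr_expi t) => ->; rewrite nr0 eq_sym oner_eq0. Qed.

Lemma expiMn t n : expi (t * n%:R) = expi t ^+ n.
Proof.
elim: n => [|n ih]; first by rewrite mulr0 expi0.
by rewrite -addn1 natrD mulrDr mulr1 expiD ih exprD.
Qed.

Lemma expi_pi : expi (pi : R) = -1.
Proof. by rewrite /expi cospi sinpi; apply/eqP; rewrite eq_complex /= oppr0 !eqxx. Qed.

Lemma expi2pi : expi (2 * pi : R) = 1.
Proof. by rewrite mulrC expiMn expi_pi sqrrN expr1n. Qed.

Lemma sin_le t : 0 <= t -> sin t <= t.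
Proof.
rewrite le_eqVlt => /predU1P[<-|t0]; first by rewrite sin0.
have [|c _] := @MVT R sin cos 0 t t0 (fun x _ => is_derive_sin x).
  by apply: continuous_subspaceT; exact: continuous_sin.
rewrite sin0 !subr0 => ->.
by rewrite -[leRHS]mul1r ler_wpM2r ?cos_le1 // ltW.
Qed.

(** The squared chord equals 4 sin(t/2)^2 by the half-angle formula, and the sine is dominated by
    its argument. *)
Lemma nr_expi_sub1 t : nr (expi t - 1) <= `|t|.
Proof.
wlog t0 : t / 0 <= t => [hw|].
  have [/hw //|/ltW t0] := leP 0 t.
  have -> : nr (expi t - 1) = nr (expi (- t) - 1).
    rewrite -[RHS]mul1r -(nr_expi t) -nrM mulrBr -expiD subrr expi0 mulr1.
    by rewrite nrBC.
  by rewrite -normrN hw // oppr_ge0.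
rewrite (ger0_norm t0).
have h : nr (expi t - 1) ^+ 2 <= t ^+ 2.
  have -> : nr (expi t - 1) ^+ 2 = (cos t - 1) ^+ 2 + sin t ^+ 2.
    apply: complexI; rewrite rmorphXn /= nrE -add_Re2_Im2 /=.
    by rewrite subr0.
  have c2 := cos2Dsin2 t.
  have e : t = t / 2 + t / 2 by field.
  have c4 : cos t = 1 - 2 * sin (t / 2) ^+ 2.
    rewrite {1}e cosD; have := cos2Dsin2 (t / 2); nra.
  have s1 : 0 <= t / 2 by rewrite divr_ge0.
  have s2 : sin (t / 2) ^+ 2 <= (t / 2) ^+ 2.
    have := sin_le s1.
    have [s0|s0] := leP 0 (sin (t / 2)).
      by move=> h; rewrite ler_sqr ?nnegrE.
    move=> _.
    have : - sin (t / 2) <= t / 2.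
      (* A negative sine forces t/2 > pi, and then t/2 exceeds 1. *)
      have [tp|tp] := leP (t / 2) pi.
        by have := @sin_ge0_pi R (t/2); rewrite s1 tp => /(_ isT); lra.
      by have := sin_geN1 (t / 2); have := pi_ge2 R; lra.
    nra.
  nra.
by rewrite -(@ler_pXn2r _ 2) // nnegrE nr_ge0.
Qed.

(** The real part decides: cosine is even and injective on [0, pi]. *)
Lemma expi_neq1 t : 0 < `|t| <= pi -> expi t != 1.
Proof.
case/andP=> t0 tp; apply/eqP => /(congr1 (@complex.Re R)) /= h.
have h1 : cos `|t| = cos 0.
  rewrite cos0 -h; have [//|_] := ger0P t.
  by rewrite cosN.
have := cos_inj _ _ h1; rewrite !in_itv /= !lexx pi_ge0 tp ltW // => /(_ isT isT).
by move=> e; rewrite e ltxx in t0.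
Qed.

End Expi.

(** * Completeness and the Neumann series *)

Section Neumann.
Variables (R : realType) (V : completeNormedModType R[i]).

Lemma geometric_lt (q D e : R) : 0 <= q < 1 -> 0 < e ->
  exists n : nat, q ^+ n * D < e.
Proof.
case/andP=> q0 q1 e0.
have h : (fun n => q ^+ n * D) @ \oo --> (0 : R).
  rewrite -(mul0r D); apply: cvgMl.
  by apply: cvg_expr; rewrite ger0_norm.
have := @cvgr_lt _ _ _ _ _ _ h e e0.
by move=> [N _ hN]; exists N; apply: (hN N) => /=.
Qed.

Lemma nr_cauchy_cvg (s : nat -> V) :
  (forall e : R, 0 < e -> exists n, forall k, nr (s (n + k)%N - s n) < e) ->
  exists l, forall e : R, 0 < e -> \forall n \near \oo, nr (l - s n) < e.
Proof.
move=> hs.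
have cs : cvg (s @ \oo).
  apply/cauchy_cvgP/cauchy_exP => e e0.
  have ee : (complex.Re e)%:C = e by rewrite RRe_real // gtr0_real.
  have e1 : 0 < complex.Re e by rewrite -ltcR ee.
  have [n hn] := hs _ e1; exists (s n); exists n => // m /= nm.
  rewrite -ball_normE /ball_ /= -nrE -ee ltcR nrBC.
  by rewrite -(subnKC nm); exact: hn.
exists (lim (s @ \oo)) => e e0.
have /cvgrPdist_lt/(_ e%:C) := cs; rewrite ltcR => /(_ e0).
by apply: filterS => n; rewrite -nrE ltcR.
Qed.

(** The iterates of v -> y + A v from 0 are the partial sums of the Neumann series. They stay
    bounded by |y| / (1 - q), and advancing both indices by one shrinks differences by q, so they
    converge to a fixed point. *)
Lemma neumann_surj (A : {linear V -> V}) (q : R) : 0 <= q < 1 ->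
  (forall x, nr (A x) <= q * nr x) -> forall y, exists x, x - A x = y.
Proof.
move=> q01 hA y; have /andP[q0 q1] := q01.
pose s k := iter k (fun v => y + A v) 0.
have hs k : nr (s k) <= nr y / (1 - q).
  have d : 0 < 1 - q by lra.
  elim: k => [|k ih]; first by rewrite nr0 divr_ge0 ?nr_ge0 // ltW.
  rewrite /= -/(s k); apply: le_trans (nrD _ _) _.
  have := hA (s k); have := ler_wpM2l q0 ih.
  have : nr y / (1 - q) = nr y + q * (nr y / (1 - q)) by field; rewrite gt_eqF.
  move: (nr y / (1 - q)) => D; lra.
have hd n k : nr (s (n + k)%N - s n) <= q ^+ n * (nr y / (1 - q)).
  elim: n => [|n ih]; first by rewrite subr0 mul1r hs.
  rewrite addSn /= -!/(s _) opprD addrACA subrr add0r -linearB exprS -mulrA.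
  by apply: le_trans (hA _) _; rewrite ler_wpM2l.
have [e e0|l hl] := @nr_cauchy_cvg s.
  have [n hn] := @geometric_lt q (nr y / (1 - q)) e q01 e0.
  by exists n => k; apply: le_lt_trans (hd _ _) hn.
exists l; apply/eqP; rewrite -subr_eq0; apply/eqP/nr_eq0/eqP.
rewrite eq_le nr_ge0 andbT; apply/ler_addgt0Pr => e e0; rewrite add0r.
have e2 : 0 < e / 2 by lra.
have [n _ hn] := hl _ e2.
have h1 : nr (l - s n) < e / 2 by apply: hn => /=.
have h2 : nr (l - s n.+1) < e / 2 by apply: hn => /=.
(* The residual is expressed through the distances of the limit to two successive iterates. *)
have -> : l - A l - y = (l - s n.+1) - A (l - s n).
  by rewrite linearB /= -/(s n) opprD opprB !addrA subrK addrAC.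
apply: le_trans (nrB _ _) _.
have := hA (l - s n); have := nr_ge0 (l - s n); nra.
Qed.

(** The inverse is chosen pointwise from surjectivity. The lower bound |x| <= |x - A x| / (1 - q)
    gives injectivity, hence linearity of the choice, and also its continuity. *)
Lemma neumann (A : {linear V -> V}) (q : R) : 0 <= q < 1 ->
  (forall x, nr (A x) <= q * nr x) ->
  exists G : {linear V -> V},
    [/\ continuous G, forall x, G (x - A x) = x & forall x, G x - A (G x) = x].
Proof.
move=> q01 hA; have /andP[q0 q1] := q01.
have d : 0 < 1 - q by lra.
have [g hg] := choice (neumann_surj q01 hA).
have low x : nr x <= nr (x - A x) / (1 - q).
  rewrite ler_pdivlMr //; have := nrB_trans 0 x (A x).
  have := nrD (x - A x) (A x); rewrite subrK; have := hA x; lra.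
have inj x y : x - A x = y - A y -> x = y.
  move=> e; apply/eqP; rewrite -subr_eq0; apply/eqP/nr_eq0/eqP.
  rewrite eq_le nr_ge0 andbT; apply: le_trans (low _) _.
  by rewrite linearB /= opprD addrACA -opprD e subrr nr0 mul0r.
have gl : linear g.
  move=> a u v; apply: inj; rewrite hg (linearP A) opprD addrACA.
  by rewrite -scalerBr !hg.
pose Gm := GRing.isLinear.Build R[i] V V *:%R g gl.
pose G : {linear V -> V} := HB.pack g Gm.
exists G; split => [|x|x]; last exact: hg.
  apply/linear_bounded_continuous/linear_boundedP.
  exists ((1 - q)^-1)%:C; split; first by rewrite complex_real.
  move=> r hr x; apply: le_trans (_ : ((1 - q)^-1)%:C * `|x| <= _).
    rewrite -!nrE -rmorphM /= lecR mulrC.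
    by apply: le_trans (low _) _; rewrite hg.
  by rewrite ler_wpM2r // ltW.
by apply: inj; rewrite hg.
Qed.

End Neumann.

(** * Vector identities as commutative ring identities *)

Section Idealization.
Variables (K : comNzRingType) (V : lmodType K).

(* The square-zero extension K + V: identities between K-linear combinations
   of vectors become ring identities in it. *)
Definition idealization : Type := (K * V)%type.

HB.instance Definition _ := GRing.Zmodule.on idealization.

Implicit Types u v w : idealization.

Definition idl_mul u v : idealization :=
  (u.1 * v.1, u.1 *: v.2 + v.1 *: u.2).

Fact idl_mulC : commutative idl_mul.
Proof. by move=> u v; rewrite /idl_mul mulrC addrC. Qed.

Fact idl_mulA : associative idl_mul.
Proof.
move=> u v w; rewrite /idl_mul /= mulrA !scalerDr !scalerA addrA.
by congr (_, _ + _ + _); rewrite mulrC.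
Qed.

Fact idl_mul1 : left_id (1, 0) idl_mul.
Proof. by case=> a x; rewrite /idl_mul /= mul1r scale1r scaler0 addr0. Qed.

Fact idl_mulDl : left_distributive idl_mul +%R.
Proof.
move=> u v w; rewrite /idl_mul /= mulrDl scalerDl scalerDr.
by congr (_, _); rewrite addrACA.
Qed.

Fact idl_neq0 : (1, 0) != 0 :> idealization.
Proof. by apply/eqP => -[/eqP]; rewrite oner_eq0. Qed.

HB.instance Definition _ := GRing.Zmodule_isComNzRing.Build idealization
  idl_mulA idl_mulC idl_mul1 idl_mulDl idl_neq0.

Definition idl_scal (a : K) : idealization := (a, 0).
Definition idl_vect (x : V) : idealization := (0, x).

Fact idl_scal_additive : additive idl_scal.
Proof. by move=> a b; congr (_, _); rewrite subr0. Qed.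

HB.instance Definition _ := GRing.isAdditive.Build K idealization idl_scal
  idl_scal_additive.

Fact idl_scal_multiplicative : multiplicative idl_scal.
Proof. by split=> // a b; congr (_, _); rewrite /= !scaler0 addr0. Qed.

HB.instance Definition _ := GRing.isMultiplicative.Build K idealization idl_scal
  idl_scal_multiplicative.

Fact idl_vect_additive : additive idl_vect.
Proof. by move=> x y; congr (_, _); rewrite subr0. Qed.

HB.instance Definition _ := GRing.isAdditive.Build V idealization idl_vect
  idl_vect_additive.

Lemma idl_vectZ a x : idl_vect (a *: x) = idl_scal a * idl_vect x.
Proof. by congr (_, _); rewrite /= ?mulr0 // scale0r addr0. Qed.

Lemma idl_vect_inj : injective idl_vect.
Proof. by move=> x y []. Qed.

End Idealization.

Ltac lmodule :=
  apply: idl_vect_inj;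
  do ?progress rewrite ?raddfD ?raddfN ?raddf0 ?idl_vectZ /=; ring.

(** * Differentiation along subsets of the circle *)

Section Qder.
Variables (R : realType) (D : set R[i]).
Hypothesis D1 : forall l, D l -> nr l = 1.

(** Here f is the derivative of F relative to D, with one constant for both sup norms and for the
    quadratic Taylor remainder. Uniformity over all pairs of points is what makes the errors of
    Riemann sums add up to O(1/p). *)
Definition qder (V : normedModType R[i]) (F f : R[i] -> V) :=
  exists2 C : R, 0 <= C & forall l l', D l -> D l' ->
  [/\ nr (F l) <= C, nr (f l) <= C &
      nr (F l' - F l - (l' - l) *: f l) <= C * nr (l' - l) ^+ 2].

Lemma nr_step l l' : D l -> D l' -> 0 <= nr (l' - l) <= 2.
Proof.
move=> /D1 h /D1 h'; rewrite nr_ge0 /=.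
by apply: le_trans (nrB _ _) _; rewrite h h'; lra.
Qed.

Section Vect.
Variable V : normedModType R[i].
Implicit Types F f G g : R[i] -> V.

Lemma qder_ext F f G g : F =1 G -> f =1 g -> qder F f -> qder G g.
Proof. by move=> /funext -> /funext ->. Qed.

Lemma qderD F f G g : qder F f -> qder G g ->
  qder (fun l => F l + G l) (fun l => f l + g l).
Proof.
move=> [C C0 hF] [E E0 hG]; exists (C + E); first exact: addr_ge0.
move=> l l' Dl Dl'; have [a1 a2 a3] := hF _ _ Dl Dl'.
have [b1 b2 b3] := hG _ _ Dl Dl'.
split; [exact: le_trans (nrD _ _) (lerD _ _)|
        exact: le_trans (nrD _ _) (lerD _ _)|].
have -> : F l' + G l' - (F l + G l) - (l' - l) *: (f l + g l) =
  (F l' - F l - (l' - l) *: f l) + (G l' - G l - (l' - l) *: g l) by lmodule.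
by rewrite mulrDl; exact: le_trans (nrD _ _) (lerD _ _).
Qed.

(** Two points of the circle are at most 2 apart, so the quadratic remainder costs 2 C times the
    distance and the linear term C. *)
Lemma qder_lip F f : qder F f -> exists2 C : R, 0 <= C &
  forall l l', D l -> D l' -> nr (F l' - F l) <= C * nr (l' - l).
Proof.
move=> [C C0 hF]; exists (3 * C); first by lra.
move=> l l' Dl Dl'; have [a1 a2 a3] := hF _ _ Dl Dl'.
have := nr_step Dl Dl'; have := nrD (F l' - F l - (l' - l) *: f l) ((l' - l) *: f l).
rewrite subrK nrZ => h /andP[d0 d2].
have p1 := ler_wpM2l d0 a2.
have p2 : C * nr (l' - l) ^+ 2 <= C * (2 * nr (l' - l)).
  by rewrite ler_wpM2l // expr2 ler_wpM2r.
lra.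
Qed.

(** Taylor remainder of a product: the remainder of each factor, plus a cross term that is quadratic
    once F is known to be Lipschitz. *)
Lemma leibniz_remainder (a a' b d : R[i]) (x x' y : V) :
  a' *: x' - a *: x - d *: (a *: y + b *: x) =
  (a' - a - d * b) *: x' + (d * b) *: (x' - x) + a *: (x' - x - d *: y).
Proof. lmodule. Qed.

Lemma qderM (h k : R[i] -> R[i]^o) F f : qder h k -> qder F f ->
  qder (fun l => h l *: F l) (fun l => h l *: f l + k l *: F l).
Proof.
move=> qh qF; have [B B0 lip] := qder_lip qF.
move: qh qF => [C C0 hh] [E E0 hF]; exists (2 * C * E + C * B).
  by rewrite addr_ge0 ?mulr_ge0.
move=> l l' Dl Dl'; have [a1 a2 a3] := hF _ _ Dl Dl'.
have [e1 _ _] := hF _ _ Dl' Dl.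
have [b1 b2 b3] : [/\ nr (h l : R[i]) <= C, nr (k l : R[i]) <= C &
    nr (h l' - h l - (l' - l) * k l : R[i]) <= C * nr (l' - l) ^+ 2] :=
  hh _ _ Dl Dl'.
have {}lip := lip _ _ Dl Dl'.
have n1 := nr_ge0 (F l); have n2 := nr_ge0 (f l); have n3 := nr_ge0 (F l').
have n4 : 0 <= nr (h l : R[i]) := nr_ge0 _; have n5 : 0 <= nr (k l : R[i]) := nr_ge0 _.
have CB : 0 <= C * B by exact: mulr_ge0.
have CE : 0 <= C * E by exact: mulr_ge0.
have m1 : nr (h l : R[i]) * nr (F l) <= C * E by exact: ler_pM.
have m2 : nr (h l : R[i]) * nr (f l) <= C * E by exact: ler_pM.
have m3 : nr (k l : R[i]) * nr (F l) <= C * E by exact: ler_pM.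
split; first by rewrite nrZ; lra.
  by apply: le_trans (nrD _ _) _; rewrite !nrZ; lra.
rewrite leibniz_remainder.
apply: le_trans (nrD _ _) _; rewrite nrZ.
have := nrD ((h l' - h l - (l' - l) * k l) *: F l')
            (((l' - l) * k l) *: (F l' - F l)).
rewrite !nrZ nrM.
have p1 : nr (h l' - h l - (l' - l) * k l : R[i]) * nr (F l') <=
  (C * nr (l' - l) ^+ 2) * E by apply: ler_pM; rewrite ?nr_ge0.
have d0 := nr_ge0 (l' - l).
have p2 : (nr (l' - l) * nr (k l : R[i])) * nr (F l' - F l) <=
  (nr (l' - l) * C) * (B * nr (l' - l)).
  by apply: ler_pM; rewrite ?mulr_ge0 ?nr_ge0 // ler_wpM2l.
have p3 : nr (h l : R[i]) * nr (F l' - F l - (l' - l) *: f l) <=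
  C * (E * nr (l' - l) ^+ 2) by apply: ler_pM; rewrite ?nr_ge0.
lra.
Qed.

Lemma qder_cst (v : V) : qder (fun=> v) (fun=> 0).
Proof.
exists (nr v); first exact: nr_ge0.
move=> l l' _ _; split=> //; first by rewrite nr0 nr_ge0.
by rewrite scaler0 subrr subr0 nr0 mulr_ge0 ?nr_ge0 // exprn_ge0 ?nr_ge0.
Qed.

End Vect.

Lemma qder_id : qder (fun l => l : R[i]^o) (fun=> 1).
Proof.
exists 1 => // l l' Dl _; rewrite /= -[nr l]/(nr (l : R[i])) D1 // nr1.
split=> //; rewrite -[_ *: _]/((l' - l) * 1) mulr1 subrr.
by rewrite -[nr _]/(nr (0 : R[i])) nr0 mul1r exprn_ge0 ?nr_ge0.
Qed.

Lemma D_neq0 l : D l -> l != 0.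
Proof. by move=> /D1; apply: contra_eq_neq => ->; rewrite nr0 eq_sym oner_eq0. Qed.

Lemma qder_inv : qder (fun l => l^-1 : R[i]^o) (fun l => - l ^- 2).
Proof.
exists 1 => // l l' Dl Dl'; have l0 := D_neq0 Dl; have l0' := D_neq0 Dl'.
split.
- by rewrite -[nr _]/(nr (l^-1 : R[i])) nrV D1 // invr1.
- by rewrite -[nr _]/(nr (- l^-2 : R[i])) nrN nrV nrX D1 // expr1n invr1.
have -> : l'^-1 - l^-1 - (l' - l) *: (- l ^- 2 : R[i]^o) =
  (l' - l) ^+ 2 / (l ^+ 2 * l') :> R[i].
  by rewrite -[_ *: _]/((l' - l) * _); field; rewrite ?l0 ?l0'.
rewrite -[nr _]/(nr (_ : R[i])) nrM nrV nrM !nrX (D1 Dl) (D1 Dl').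
by rewrite !(expr1n, mulr1, invr1, mul1r).
Qed.

Lemma invexp_identity (F : fieldType) (l a b : F) : l != 0 -> a != 0 ->
  l^-1 * (- (b + 1) * (l * (l * a))^-1) + - (l ^+ 2)^-1 * (l * a)^-1 =
  - (b + 1 + 1) * (l * (l * (l * a)))^-1.
Proof. by move=> l0 a0; field; rewrite ?l0 ?a0. Qed.
Lemma derivative_expNz (l : R[i]) n : l != 0 ->
  l^-1 * ((Negz n)%:~R * l ^ (Negz n.+1)) + - (l ^+ 2)^-1 * l ^ (Negz n) = (Negz n.+1)%:~R * l ^ (Negz n.+2).
Proof.
move=> l0.
have := @invexp_identity R[i] l (l ^+ n) n%:R l0 (expf_neq0 n l0).
rewrite -!exprS !natr1 => e.
by rewrite (NegzE n) mulrNz (NegzE n.+1) mulrNz.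
Qed.

(** The product rule is applied repeatedly with the factor l or its inverse. Negative exponents are
    included because the frequencies run through both signs. *)
Lemma qder_exp (z : int) :
  qder (fun l => l ^ z : R[i]^o) (fun l => z%:~R * l ^ (z - 1)).
Proof.
(* Functions are compared on D only: the power laws require l to be nonzero, which membership in D
   guarantees. *)
have qext (F f G g : R[i] -> R[i]^o) : (forall l, D l -> F l = G l) ->
    (forall l, D l -> f l = g l) -> qder F f -> qder G g.
  move=> e1 e2 [C C0 h]; exists C => // l l' Dl Dl'.
  by rewrite -!e1 // -e2 //; exact: h.
case: z => n.
  elim: n => [|n ih]; first by apply: qext (qder_cst (1 : R[i]^o)) => l _; rewrite ?expr0z ?mul0r.
  apply: qext (qderM qder_id ih) => l Dl.
    by rewrite -[_ *: _]/(_ * _) -exprS.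
  rewrite -[_ *: _]/(l * _) -[1 *: _]/(1 * _) mul1r mulrCA -{1}[l]expr1z.
  rewrite -expfzDr ?D_neq0 //.
  have aux (i j k : int) : i = k -> j = k ->
      n%:~R * l ^ i + l ^ k = n.+1%:~R * l ^ j :> R[i].
    by move=> -> ->; rewrite -addn1 PoszD rmorphD /= mulrDl mul1r.
  by apply: aux; lia.
elim: n => [|n ih].
  by apply: qext qder_inv => l Dl; rewrite ?expN1r //= mulN1r.
apply: qext (qderM qder_inv ih) => l Dl.
  by rewrite -[_ *: _]/(_ * _) -invfM -exprS.
have l0 := D_neq0 Dl.
rewrite -[_ *: _]/(l^-1 * _) -[- _ *: _]/(- _ * _).
have -> : Negz n - 1 = Negz n.+1 by lia.
have -> : Negz n.+1 - 1 = Negz n.+2 by lia.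
exact: derivative_expNz.
Qed.

End Qder.

(** * Upper bounds for limits superior *)

Section AsymptoticBound.
Variables (R : realType).

(* limsup |y p| <= b *)
Definition asle (V : normedModType R[i]) (y : nat -> V) (b : R) :=
  forall e : R, 0 < e -> \forall p \near \oo, nr (y p) <= b + e.

(** Controls discretisation errors; with A = e = 1 it merely supplies that p is eventually
    positive. *)
Lemma near_div_le (A e : R) : 0 < e ->
  \forall p \near \oo, (0 < p)%N /\ A / p%:R <= e.
Proof.
move=> e0; have [N hN] : exists N : nat, A / e < N%:R.
  exists (Num.bound `|A / e|); apply: le_lt_trans (ler_norm _) _.
  exact: archi_boundP.
exists N.+1 => // p /= Np; have p0 : (0 < p)%N by exact: leq_ltn_trans Np.
split=> //; rewrite ler_pdivrMr ?ltr0n // mulrC -ler_pdivrMr //.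
by apply: le_trans (ltW hN) _; rewrite ler_nat ltnW.
Qed.

Variable V : normedModType R[i].
Implicit Types y : nat -> V.

Lemma asle_near y y' b : (\forall p \near \oo, y p = y' p) -> asle y b -> asle y' b.
Proof.
by move=> h hy e e0; have := hy e e0; apply: filterS2 h => p -> .
Qed.

Lemma asle_bound y b : (\forall p \near \oo, nr (y p) <= b) -> asle y b.
Proof.
move=> h e e0; apply: filterS h => p /le_trans; apply.
by rewrite lerDl ltW.
Qed.

Lemma asle_le y b b' : b <= b' -> asle y b -> asle y b'.
Proof.
move=> h hy e e0; have := hy e e0; apply: filterS => p /le_trans; apply.
by rewrite lerD2r.
Qed.

Lemma asleD y y' b b' : asle y b -> asle y' b' ->
  asle (fun p => y p + y' p) (b + b').
Proof.
move=> h h' e e0; have e2 : 0 < e / 2 by lra.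
have := h _ e2; have := h' _ e2; apply: filterS2 => p hp hp'.
by apply: le_trans (nrD _ _) _; lra.
Qed.

Lemma asleN y b : asle y b -> asle (fun p => - y p) b.
Proof. by move=> h e e0; apply: filterS (h e e0) => p; rewrite nrN. Qed.

Lemma asle_sum (I : Type) (r : seq I) (Y : I -> nat -> V) (b : I -> R) :
  (forall i, asle (Y i) (b i)) ->
  asle (fun p => \sum_(i <- r) Y i p) (\sum_(i <- r) b i).
Proof.
move=> h; elim: r => [|i r ih].
  by apply: asle_bound; apply: nearW => p; rewrite !big_nil nr0.
rewrite big_cons; apply: asle_near (asleD (h i) ih).
by apply: nearW => p; rewrite big_cons.
Qed.

Lemma asle_map (A : V -> V) (M : R) y b : 0 <= M ->
  (forall x, nr (A x) <= M * nr x) -> asle y b -> asle (fun p => A (y p)) (M * b).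
Proof.
(* Dividing by M + 1 instead of M covers the case M = 0. *)
move=> M0 hA hy e e0; have e1 : 0 < e / (M + 1) by rewrite divr_gt0 //; lra.
apply: filterS (hy _ e1) => p hp; apply: le_trans (hA _) _.
apply: le_trans (ler_wpM2l M0 hp) _; rewrite mulrDr lerD2l.
rewrite mulrA ler_pdivrMr; last lra.
by rewrite mulrDr mulr1 mulrC lerDl ltW.
Qed.

Lemma asleZ (a : R[i]) y b : asle y b -> asle (fun p => a *: y p) (nr a * b).
Proof.
by apply: (@asle_map (fun x => a *: x)) => [|x]; rewrite ?nr_ge0 // nrZ.
Qed.

Lemma asle_cst (v : V) b : asle (fun=> v) b -> nr v <= b.
Proof.
move=> h; apply/ler_addgt0Pr => e e0.
by have [N _ hN] := h e e0; apply: (hN N) => /=.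
Qed.

End AsymptoticBound.

(** * Riemann sums over roots of unity *)

Section RiemannSum.
Variables (R : realType) (L : nat).
Hypothesis L0 : (0 < L)%N.

(** The circle is cut into L basic arcs and each of these into p steps; the nodes separating the
    basic arcs are the powers of [root 1], whatever p is. *)
Definition root (p : nat) : R[i] := expi (2 * pi / (p * L)%:R).

Lemma nr_root p : nr (root p) = 1.
Proof. exact: nr_expi. Qed.

Lemma root_neq0 p : root p != 0.
Proof. exact: expi_neq0. Qed.

Lemma root_exp p j : (0 < p)%N ->
  root p ^+ j = expi (2 * pi * (j%:R / (p * L)%:R)).
Proof. by move=> p0; rewrite -expiMn; congr expi; rewrite mulrAC mulrA. Qed.

Lemma root_expp p : (0 < p)%N -> root p ^+ p = root 1.
Proof.
move=> p0; rewrite root_exp // /root mul1n; congr expi.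
by rewrite natrM; field; rewrite !pnatr_eq0 -!lt0n p0 L0.
Qed.

Lemma root_expM p u : (0 < p)%N -> root p ^+ (p * u) = root 1 ^+ u.
Proof. by move=> p0; rewrite exprM root_expp. Qed.

Lemma root_period p : (0 < p)%N -> root p ^+ (p * L) = 1.
Proof.
move=> p0; rewrite root_exp // divff ?mulr1 ?expi2pi //.
by rewrite pnatr_eq0 -lt0n muln_gt0 p0.
Qed.

Lemma pi_le4 : (pi : R) <= 4.
Proof. by have [/andP[_ h] _] := pihalf_02_cos_pihalf R; lra. Qed.

Lemma nr_root_sub1 p : (0 < p)%N -> nr (root p - 1) <= 8 / (p * L)%:R.
Proof.
move=> p0; apply: le_trans (nr_expi_sub1 _) _.
have h := pi_ge0 R; have h4 := pi_le4.
rewrite ger0_norm ?mulr_ge0 ?invr_ge0 ?ler0n //.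
by rewrite ler_wpM2r ?invr_ge0 ?ler0n //; lra.
Qed.

Lemma nr_exp_sub1 (w : R[i]) j : nr w = 1 -> nr (w ^+ j - 1) <= j%:R * nr (w - 1).
Proof.
move=> w1; elim: j => [|j ih]; first by rewrite subrr nr0 mul0r.
have -> : w ^+ j.+1 - 1 = w ^+ j * (w - 1) + (w ^+ j - 1) by rewrite exprS; ring.
apply: le_trans (nrD _ _) _; rewrite nrM nrX w1 expr1n mul1r.
by rewrite -natr1 mulrDl mul1r addrC lerD2r.
Qed.

(* Tends to 2 i pi. *)
Definition sigma (p : nat) : R[i] := (p * L)%:R * (root p - 1).

(** The p h steps from 1 to -1 cover a chord of length 2, so one step is at least 2 / (p h), which
    is 4 / (p L). *)
Lemma sigma_ge4 p h : L = h.*2 -> (0 < p)%N -> 4 <= nr (sigma p).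
Proof.
move=> Lh p0; have h0 : (0 < h)%N by move: L0; rewrite Lh double_gt0.
have e : root p ^+ (p * h) = -1.
  rewrite root_exp // -expi_pi; congr expi.
  rewrite Lh -muln2 mulnA (natrM _ (p * h)).
  by field; rewrite !pnatr_eq0 -!lt0n ?muln_gt0 ?p0 ?h0.
have := nr_exp_sub1 (p * h) (nr_root p).
have -> : root p ^+ (p * h) - 1 = - 2%:R by rewrite e; ring.
rewrite nrN nr_nat /sigma nrM nr_nat Lh -muln2 mulnA (natrM _ (p * h)).
lra.
Qed.

Section Vect.
Variable V : normedModType R[i].
Implicit Types f F : R[i] -> V.

(* A Riemann sum for (2 i pi)^-1 times the integral of [f] over the arc
   2 pi u / L <= arg l <= 2 pi v / L. *)
Definition rsum f (u v p : nat) : V :=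
  (p * L)%:R^-1 *: \sum_(p * u <= j < p * v) root p ^+ j *: f (root p ^+ j).

Lemma rsumD f f' u v p :
  rsum (fun l => f l + f' l) u v p = rsum f u v p + rsum f' u v p.
Proof.
rewrite /rsum -scalerDr -big_split /=; congr (_ *: _).
by apply: eq_bigr => j _; rewrite scalerDr.
Qed.

Lemma rsumZ (a : R[i]) f u v p : rsum (fun l => a *: f l) u v p = a *: rsum f u v p.
Proof.
rewrite /rsum scalerA mulrC -scalerA scaler_sumr; congr (_ *: _).
by apply: eq_bigr => j _; rewrite !scalerA mulrC.
Qed.

Lemma nr_rsum f u v p (B : R) : (0 < p)%N -> (u <= v)%N ->
  (forall j, (p * u <= j)%N -> (j < p * v)%N -> nr (f (root p ^+ j)) <= B) ->
  nr (rsum f u v p) <= (v - u)%:R / L%:R * B.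
Proof.
move=> p0 uv hB; rewrite /rsum nrZ nrV nr_nat.
have hs : nr (\sum_(p * u <= j < p * v) root p ^+ j *: f (root p ^+ j)) <=
    (p * (v - u))%:R * B.
  apply: le_trans (nr_sum _ _ _) _.
  rewrite mulnBr.
  apply: le_trans (_ : \sum_(p * u <= j < p * v) B <= _); last first.
    by rewrite sumr_const_nat mulr_natl.
  apply: ler_sum_nat => j /andP[h1 h2].
  by rewrite nrZ nrX nr_root expr1n mul1r hB.
apply: le_trans (ler_wpM2l _ hs) _; first by rewrite invr_ge0 ler0n.
rewrite !natrM le_eqVlt; apply/orP; left; apply/eqP; field.
by rewrite !pnatr_eq0 -!lt0n L0.
Qed.

(** Fundamental theorem of calculus. The difference of primitives telescopes over the sample points;
    each of the p (v - u) steps has error at most C (8 / (p L))^2, so the total is O(1/p). *)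
Lemma rsum_ftc (D : set R[i]) F f u v : (forall l, D l -> nr l = 1) ->
  (u <= v)%N -> qder D F f ->
  (forall p j, (0 < p)%N -> (p * u <= j <= p * v)%N -> D (root p ^+ j)) ->
  asle (fun p => sigma p *: rsum f u v p - (F (root 1 ^+ v) - F (root 1 ^+ u))) 0.
Proof.
move=> D1 uv [C C0 hF] hD e e0.
apply: filterS (near_div_le ((v - u)%:R * C * 64 / L%:R ^+ 2) e0) => p [p0 hp].
rewrite add0r; apply: le_trans hp.
have N0 : (p * L)%:R != 0 :> R[i] by rewrite pnatr_eq0 -lt0n muln_gt0 p0.
have -> : sigma p *: rsum f u v p = \sum_(p * u <= j < p * v)
    (root p ^+ j.+1 - root p ^+ j) *: f (root p ^+ j).
  rewrite /rsum /sigma scalerA mulrAC divff // mul1r.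
  rewrite scaler_sumr; apply: eq_bigr => j _.
  by rewrite scalerA; congr (_ *: _); rewrite exprS; ring.
have -> : F (root 1 ^+ v) - F (root 1 ^+ u) = \sum_(p * u <= j < p * v)
    (F (root p ^+ j.+1) - F (root p ^+ j)).
  by rewrite (telescope_sumr (fun j => F (root p ^+ j))) ?leq_mul2l ?uv ?orbT // !root_expM.
rewrite -sumrB; apply: le_trans (nr_sum _ _ _) _.
apply: le_trans (_ : \sum_(p * u <= j < p * v) C * (8 / (p * L)%:R) ^+ 2 <= _).
  apply: ler_sum_nat => j /andP[h1 h2].
  have Dj : D (root p ^+ j) by apply: hD => //; rewrite h1 ltnW.
  have Dj' : D (root p ^+ j.+1) by apply: hD => //; rewrite h2 leqW.
  have [_ _ h] := hF _ _ Dj Dj'; rewrite nrBC; apply: le_trans h _.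
  rewrite ler_wpM2l // ler_sqr ?nnegrE ?nr_ge0 ?divr_ge0 ?ler0n //.
  have -> : root p ^+ j.+1 - root p ^+ j = root p ^+ j * (root p - 1).
    by rewrite exprSr mulrBr mulr1.
  by rewrite nrM nrX nr_root expr1n mul1r nr_root_sub1.
rewrite sumr_const_nat -mulnBr -[_ *+ _]mulr_natl !natrM le_eqVlt; apply/orP; left.
by apply/eqP; field; rewrite !pnatr_eq0 -!lt0n ?p0 ?L0.
Qed.

End Vect.

End RiemannSum.

Ltac nneg := repeat (first [ done | exact: nr_ge0 | exact: ler0n
  | apply: exprn_ge0 | apply: mulr_ge0 | apply: addr_ge0 ]).

(** * Smoothness of powers of the resolvent *)

Section Resolvent.
Variables (R : realType) (V : normedModType R[i]) (T : {linear V -> V}).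
Variables (D : set R[i]) (S : R[i] -> {linear V -> V}) (mu : R).
Hypothesis D1 : forall l, D l -> nr l = 1.
Hypothesis mu0 : 0 <= mu.
Hypothesis SK : forall l x, D l -> S l (l *: x - T x) = x.
Hypothesis KS : forall l x, D l -> l *: S l x - T (S l x) = x.
Hypothesis S_le : forall l x, D l -> nr (S l x) <= mu * nr x.

Lemma resolvent_identity l l' y : D l -> D l' ->
  S l' y = S l y - (l' - l) *: S l' (S l y).
Proof.
move=> Dl Dl'; rewrite -{1}(KS y Dl).
have -> : l *: S l y - T (S l y) =
    (l' *: S l y - T (S l y)) - (l' - l) *: S l y by lmodule.
by rewrite linearB /= SK // linearZ.
Qed.

Lemma nr_resolvent_iter l k x : D l -> nr (iter k (S l) x) <= mu ^+ k * nr x.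
Proof.
move=> Dl; elim: k => [|k ih]; first by rewrite mul1r.
by apply: le_trans (S_le _ Dl) _; rewrite exprS -mulrA ler_wpM2l.
Qed.

(** By the resolvent identity, the Taylor remainder for the power k + 1 is exactly S l' applied to
    the one for k, plus (k + 1) (l' - l)^2 S l' (S l)^(k + 2) x. An induction on k therefore keeps
    it quadratic. *)
Lemma qder_resolvent k x : qder D (fun l => iter k (S l) x)
  (fun l => - k%:R *: iter k.+1 (S l) x).
Proof.
have bd k' l : D l -> nr (- k'%:R *: iter k'.+1 (S l) x) <= k'%:R * (mu ^+ k'.+1 * nr x).
  by move=> Dl; rewrite nrZ nrN nr_nat ler_wpM2l ?ler0n // nr_resolvent_iter.
have [C C0 hC] : exists2 C : R, 0 <= C & forall l l', D l -> D l' ->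
    nr (iter k (S l') x - iter k (S l) x - (l' - l) *: (- k%:R *: iter k.+1 (S l) x))
    <= C * nr (l' - l) ^+ 2; last first.
  exists (mu ^+ k * nr x + k%:R * (mu ^+ k.+1 * nr x) + C).
    by nneg.
  move=> l l' Dl Dl'.
  have t1 : 0 <= mu ^+ k * nr x by nneg.
  have t2 : 0 <= k%:R * (mu ^+ k.+1 * nr x) by nneg.
  split.
  - by apply: le_trans (nr_resolvent_iter k x Dl) _; lra.
  - by apply: le_trans (bd k l Dl) _; lra.
  - apply: le_trans (hC _ _ Dl Dl') _.
    by rewrite ler_wpM2r ?exprn_ge0 ?nr_ge0 // lerDr addr_ge0.
elim: k => [|k [C C0 ih]].
  exists 0 => // l l' _ _; rewrite /= oppr0 scale0r scaler0 !subrr.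
  by rewrite nr0 mul0r.
exists (mu * C + k.+1%:R * (mu * (mu ^+ k.+2 * nr x))).
  by nneg.
move=> l l' Dl Dl'.
have -> : iter k.+1 (S l') x - iter k.+1 (S l) x -
    (l' - l) *: (- k.+1%:R *: iter k.+2 (S l) x) =
  S l' (iter k (S l') x - iter k (S l) x - (l' - l) *: (- k%:R *: iter k.+1 (S l) x))
  + (k.+1%:R * (l' - l) ^+ 2) *: S l' (iter k.+2 (S l) x).
  have e1 := resolvent_identity (iter k (S l) x) Dl Dl'.
  have e2 := resolvent_identity (iter k.+1 (S l) x) Dl Dl'.
  rewrite !linearB /= !linearZ /= e1 -natr1.
  have -> : (k%:R + 1) * (l' - l) ^+ 2 = ((k%:R + 1) * (l' - l)) * (l' - l) by ring.
  have -> : (((k%:R + 1) * (l' - l)) * (l' - l)) *: S l' (S l (S l (iter k (S l) x))) =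
    ((k%:R + 1) * (l' - l)) *: (S l (S l (iter k (S l) x)) - S l' (S l (iter k (S l) x))).
    by rewrite [S l' (S l (iter _ _ _))]e2 -scalerA /=; congr (_ *: _); lmodule.
  by lmodule.
apply: le_trans (nrD _ _) _; rewrite mulrDl; apply: lerD.
  apply: le_trans (S_le _ Dl') _; rewrite -mulrA; apply: ler_wpM2l => //.
  exact: ih.
rewrite nrZ nrM nr_nat nrX [leRHS]mulrAC; apply: ler_wpM2l; first by nneg.
apply: le_trans (S_le _ Dl') _; apply: ler_wpM2l => //.
exact: nr_resolvent_iter.
Qed.

End Resolvent.

(** * Integration by parts against piecewise affine weights *)

Section PiecewiseAffine.
Variables (R : realType) (L h : nat).
Hypotheses (L0 : (0 < L)%N) (Lh : L = h.*2).
Variables (D : set R[i]) (V : normedModType R[i]).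
Hypothesis D1 : forall l, D l -> nr l = 1.

Implicit Types (c : R[i] * R[i]) (G : R[i] -> V).

(* A piece ((u, v), (a, b)) is the weight [a l + b] on the arc
   [2 pi u / L <= arg l < 2 pi v / L]. *)
Local Notation pieces := (seq ((nat * nat) * (R[i] * R[i]))).

Definition term (z : int) c G l : V := l ^ z *: ((c.1 * l + c.2) *: G l).

Definition psum (s : pieces) z G p : V :=
  \sum_(q <- s) rsum L (term z q.2 G) q.1.1 q.1.2 p.

(** The derivative of the weight inside each piece; discontinuities at the nodes are accounted for
    by [jump]. *)
Definition slopes (s : pieces) : pieces := [seq (q.1, (0, q.2.1)) | q <- s].

(** Boundary terms of the integration by parts. At a node where the weight is continuous the
    contributions of the two adjacent pieces cancel. *)
Definition jump (s : pieces) z G : V :=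
  \sum_(q <- s) (term z q.2 G (root R L 1 ^+ q.1.2) - term z q.2 G (root R L 1 ^+ q.1.1)).

(** Both endpoints are included, since the telescoped sum evaluates the primitive there. *)
Definition arc_in u v := (u <= v)%N /\
  forall p j, (0 < p)%N -> (p * u <= j <= p * v)%N -> D (root R L p ^+ j).

Lemma qder_term z c G g : qder D G g ->
  qder D (term (z + 1) c G) (fun l =>
    (z + 1)%:~R *: term z c G l + (term (z + 1) (0, c.1) G l + term (z + 1) c g l)).
Proof.
move=> qG.
have qa : qder D (fun l => c.1 * l + c.2 : R[i]^o) (fun=> c.1).
  apply: qder_ext (qderD (qderM D1 (qder_cst D (c.1 : R[i]^o)) (qder_id D1))
                         (qder_cst D (c.2 : R[i]^o))) => l //.
  by rewrite addr0 -[_ *: _]/(c.1 * 1) -[0 *: _]/(0 * l) mulr1 mul0r addr0.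
apply: qder_ext (qderM D1 (qder_exp D1 (z + 1)) (qderM D1 qa qG)) => l //.
rewrite /term /= addrK mul0r add0r -scalerA.
by rewrite addrC scalerDr [X in _ + X]addrC.
Qed.

(** The fundamental theorem is applied on each piece to l^(z+1) W(l) G(l). The derivative of G is
    written - k G' to fit G = R(l,T)^k and G' = R(l,T)^(k+1). *)
Lemma psum_parts (s : pieces) z (k : R[i]) G G' :
  (forall q, q \in s -> arc_in q.1.1 q.1.2) ->
  qder D G (fun l => - k *: G' l) ->
  asle (fun p => sigma R L p *: ((z + 1)%:~R *: psum s z G p +
    psum (slopes s) (z + 1) G p - k *: psum s (z + 1) G' p) - jump s (z + 1) G) 0.
Proof.
move=> hs qG; rewrite /psum /slopes /jump.
elim: s hs => [|q s ih] hs.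
  apply: asle_bound; apply: nearW => p.
  by rewrite !big_nil !(scaler0, addr0, subr0) nr0.
have [uv hD] : arc_in q.1.1 q.1.2 by apply: hs; rewrite inE eqxx.
have {}ih := ih (fun q' hq' => hs q' (mem_behead (hq' : q' \in behead (q :: s)))).
have := asleD (rsum_ftc L0 D1 uv (qder_term z q.2 qG) hD) ih.
rewrite addr0; apply: asle_near; apply: nearW => p.
rewrite /= !big_cons !rsumD rsumZ.
have -> : rsum L (term (z + 1) q.2 (fun l => - k *: G' l)) q.1.1 q.1.2 p =
    - k *: rsum L (term (z + 1) q.2 G') q.1.1 q.1.2 p.
  rewrite -rsumZ; congr (rsum _ _ _ _ _); apply/funext => l.
  by rewrite /term !scalerA; congr (_ *: _); ring.
move: (rsum _ _ _ _ _) (rsum _ _ _ _ _) (rsum _ _ _ _ _) => x1 x2 x3.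
move: (\sum_(_ <- _) _) (\sum_(_ <- _) _) (\sum_(_ <- _) _) (\sum_(_ <- _) _) => y1 y2 y3 y4.
move: (term _ _ _ _) (term _ _ _ _) => z1 z2.
by lmodule.
Qed.

(** Removes the factor [sigma], whose modulus is at least 4. *)
Lemma asle_sigma (y : nat -> V) v :
  asle (fun p => sigma R L p *: y p - v) 0 -> asle y (nr v / 4).
Proof.
move=> hy e e0; have e4 : 0 < 4 * e by lra.
apply: filterS2 (@near_div_le R 1 1 ltr01) (hy _ e4) => p [p0 _] hp.
have := @sigma_ge4 R L L0 p h Lh p0; have := nrD (sigma R L p *: y p - v) v.
rewrite subrK nrZ; have := nr_ge0 (y p); nra.
Qed.

Lemma nr_psum (s : pieces) z G p (B : R) : (0 < p)%N ->
  (forall q, q \in s -> arc_in q.1.1 q.1.2) ->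
  (forall q j, q \in s -> (p * q.1.1 <= j)%N -> (j < p * q.1.2)%N ->
    nr ((q.2.1 * root R L p ^+ j + q.2.2) *: G (root R L p ^+ j)) <= B) ->
  nr (psum s z G p) <= \sum_(q <- s) (q.1.2 - q.1.1)%:R / L%:R * B.
Proof.
move=> p0 hs hB; apply: le_trans (nr_sum _ _ _) _.
rewrite big_seq [leRHS]big_seq; apply: ler_sum => q qs.
apply: (nr_rsum L0) => // [|j h1 h2]; first by have [] := hs _ qs.
rewrite /term nrZ nrXz ?mul1r; last by rewrite nrX nr_root expr1n.
exact: hB.
Qed.

End PiecewiseAffine.

(* Otherwise unification unfolds [root] down to the series of cos and sin. *)
Opaque root.

(** * The two weights and the decay of the low part *)

Section Weights.
Variables (R : realType) (h : nat).
Hypothesis h3 : (2 < h)%N.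
Local Notation L := (h.*2).
Local Notation zeta := (root R L 1).

Let L0 : (0 < L)%N. Proof. by rewrite double_gt0; case: (h) h3. Qed.

Let zeta0 : zeta != 0. Proof. exact: root_neq0. Qed.

Lemma zetaL : zeta ^+ L = 1.
Proof. by have := @root_period R L L0 1 isT; rewrite mul1n. Qed.

Lemma zetaL1 : zeta ^+ (L - 1) = zeta^-1.
Proof.
apply: (mulIf zeta0); rewrite -exprSr mulVf // subn1 prednK ?zetaL //.
Qed.

Lemma zetaL2 : zeta ^+ (L - 2) = zeta ^- 2.
Proof.
have z2 : zeta ^+ 2 != 0 by rewrite expf_neq0.
apply: (mulIf z2); rewrite -exprD mulVf // subnK ?zetaL //; have := h3; lia.
Qed.

(* [low] + [high] is the weight [l - 1] on the whole circle; both are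
   continuous, [high] vanishes near 1 and [low] away from 1. *)
Definition high : seq ((nat * nat) * (R[i] * R[i])) :=
  [:: ((1, 2)%N, (1 + zeta^-1, - (zeta + 1)));
      ((2, L - 2)%N, (1, -1));
      ((L - 2, L - 1)%N, (1 + zeta, - (zeta^-1 + 1)))].

Definition low : seq ((nat * nat) * (R[i] * R[i])) :=
  [:: ((0, 1)%N, (1, -1));
      ((1, 2)%N, (- zeta^-1, zeta));
      ((L - 2, L - 1)%N, (- zeta, zeta^-1));
      ((L - 1, L)%N, (1, -1))].

Section Jump.
Variables (V : normedModType R[i]) (z : int) (G : R[i] -> V).

(** The weight vanishes at zeta and zeta^-1 and is continuous at zeta^2 and zeta^-2. *)
Lemma jump_high : jump L high z G = 0.
Proof.
rewrite /jump /high !big_cons big_nil /term /= zetaL1 zetaL2 expr1.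
have -> : (1 + zeta^-1) * zeta ^+ 2 + - (zeta + 1) = zeta ^+ 2 - 1 by field.
have -> : (1 + zeta^-1) * zeta + - (zeta + 1) = 0 by field.
have -> : (1 + zeta) * zeta^-1 + - (zeta^-1 + 1) = 0 by field.
have -> : (1 + zeta) * zeta ^- 2 + - (zeta^-1 + 1) = zeta ^- 2 - 1 by field.
have -> : 1 * zeta ^+ 2 + -1 = zeta ^+ 2 - 1 by rewrite mul1r.
have -> : 1 * zeta ^- 2 + -1 = zeta ^- 2 - 1 by rewrite mul1r.
move: (G _) (G _) (G _) (G _) => g1 g2 g3 g4.
move: (zeta ^+ 2 - 1) (zeta ^- 2 - 1) => c1 c2.
move: (_ ^ z) (_ ^ z) (_ ^ z) (_ ^ z) => a1 a2 a3 a4.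
by lmodule.
Qed.

(** The weight vanishes at 1, zeta^2 and zeta^-2 and is continuous at zeta and zeta^-1. *)
Lemma jump_low (x : V) : jump L low z (fun=> x) = 0.
Proof.
rewrite /jump /low !big_cons big_nil /term /= zetaL1 zetaL2 expr1 expr0.
rewrite zetaL.
have -> : - zeta^-1 * zeta ^+ 2 + zeta = 0 by field.
have -> : - zeta^-1 * zeta + zeta = 1 * zeta + -1 by field.
have -> : - zeta * zeta^-1 + zeta^-1 = 1 * zeta^-1 + -1 by field.
have -> : - zeta * zeta ^- 2 + zeta^-1 = 0 by field.
have -> : 1 * 1 + -1 = 0 :> R[i] by ring.
move: (1 * zeta + -1) (1 * zeta^-1 + -1) => c1 c2.
move: (_ ^ z) (_ ^ z) (_ ^ z) (_ ^ z) (_ ^ z) => a1 a2 a3 a4 a5.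
by lmodule.
Qed.

Lemma psum_slopes2 (s : seq ((nat * nat) * (R[i] * R[i]))) p :
  psum L (slopes (slopes s)) z G p = 0.
Proof.
rewrite /psum /slopes -map_comp big_map big1 // => q _ /=.
rewrite /rsum big1 ?scaler0 // => j _.
by rewrite /term /= mul0r add0r scale0r !scaler0.
Qed.

Lemma nr_jump_slopes (s : seq ((nat * nat) * (R[i] * R[i]))) (B : R) :
  (forall q, q \in s -> nr (G (zeta ^+ q.1.1)) <= B /\ nr (G (zeta ^+ q.1.2)) <= B) ->
  nr (jump L (slopes s) z G) <= \sum_(q <- s) nr q.2.1 * (B + B).
Proof.
move=> hB; rewrite /jump /slopes big_map; apply: le_trans (nr_sum _ _ _) _.
rewrite big_seq [leRHS]big_seq; apply: ler_sum => q qs /=.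
have [b1 b2] := hB _ qs; rewrite /term /= !mul0r !add0r.
apply: le_trans (nrB _ _) _; rewrite !nrZ !nrXz ?nrX ?nr_root ?expr1n // !mul1r.
by rewrite mulrDr lerD // ler_wpM2l // nr_ge0.
Qed.

End Jump.

Lemma nr_zeta : nr zeta = 1.
Proof. exact: nr_root. Qed.

Lemma nr_zetaV : nr (zeta^-1) = 1.
Proof. by rewrite nrV nr_zeta invr1. Qed.

Lemma high_slope_le q : q \in high -> nr q.2.1 <= 2.
Proof.
have := nrD 1 zeta; have := nrD 1 (zeta^-1); rewrite nr1 nr_zeta nr_zetaV.
move=> h1 h2; rewrite !inE => /or3P[]/eqP-> /=; rewrite ?nr1; lra.
Qed.

Lemma high_weight_le q l : nr l = 1 -> q \in high -> nr (q.2.1 * l + q.2.2) <= 4.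
Proof.
move=> l1 hq; have h1 := high_slope_le hq.
apply: le_trans (nrD _ _) _; rewrite nrM l1 mulr1.
have : nr q.2.2 <= 2; last by lra.
have := nrD zeta 1; have := nrD (zeta^-1) 1; rewrite nr1 nr_zeta nr_zetaV.
by move: hq; rewrite !inE => /or3P[]/eqP-> /=; rewrite nrN ?nr1; lra.
Qed.

Lemma nr_root_dist p i j : (0 < p)%N -> (i <= j)%N -> (j - i <= p)%N ->
  nr (root R L p ^+ j - root R L p ^+ i) <= 8 / L%:R.
Proof.
move=> p0 ij ijp.
have -> : root R L p ^+ j - root R L p ^+ i =
    root R L p ^+ i * (root R L p ^+ (j - i) - 1).
  by rewrite mulrBr mulr1 -exprD subnKC.
rewrite nrM nrX nr_root expr1n mul1r.
apply: le_trans (nr_exp_sub1 _ (nr_root _ _ _)) _.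
have h1 := @nr_root_sub1 R L p p0.
apply: le_trans (_ : p%:R * (8 / (p * L)%:R) <= _).
  by apply: ler_pM; rewrite ?ler0n ?nr_ge0 ?ler_nat.
rewrite natrM le_eqVlt; apply/orP; left; apply/eqP; field.
by rewrite !pnatr_eq0 -!lt0n p0 L0.
Qed.

(** On each of the four arcs the modulus of the weight is the distance to the endpoint where it
    vanishes, that is to 1, zeta^2 or zeta^-2. *)
Lemma low_weight_le q p j : (0 < p)%N -> q \in low ->
  (p * q.1.1 <= j)%N -> (j < p * q.1.2)%N ->
  nr (q.2.1 * root R L p ^+ j + q.2.2) <= 8 / L%:R.
Proof.
move=> p0; rewrite !inE => /or4P[]/eqP-> /= j1 j2.
- by rewrite mul1r -[1]/(root R L p ^+ 0) nr_root_dist //; lia.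
- have -> : - zeta^-1 * root R L p ^+ j + zeta =
      zeta^-1 * (root R L p ^+ (p * 2) - root R L p ^+ j).
    by rewrite root_expM //; field.
  by rewrite nrM nr_zetaV mul1r nr_root_dist //; lia.
- have -> : - zeta * root R L p ^+ j + zeta^-1 =
      - zeta * (root R L p ^+ j - root R L p ^+ (p * (L - 2))).
    by rewrite root_expM // zetaL2; field.
  by rewrite nrM nrN nr_zeta mul1r nr_root_dist //; nia.
- have -> : 1 * root R L p ^+ j + -1 =
      - (root R L p ^+ (p * L) - root R L p ^+ j).
    by rewrite root_period //; ring.
  by rewrite nrN nr_root_dist //; nia.
Qed.

Lemma low_arc (D : set R[i]) q : (forall l : R[i], nr l = 1 -> D l) -> q \in low ->
  arc_in L D q.1.1 q.1.2.
Proof.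
move=> hD; rewrite !inE => /or4P[]/eqP-> /=; split; try (by lia);
  by move=> p j _ _; apply: hD; rewrite nrX nr_root expr1n.
Qed.

Lemma high_arc (D : set R[i]) q : arc_in L D 1 (L - 1) -> q \in high -> arc_in L D q.1.1 q.1.2.
Proof.
move=> [_ hD]; rewrite !inE => /or3P[]/eqP-> /=; split; try (by lia);
  by move=> p j p0 hj; apply: hD => //; nia.
Qed.

Section Low.
Variables (V : normedModType R[i]) (x : V).

(** Four arcs of normalised length 1 / L, with a weight of at most 8 / L. *)
Lemma low_small z : asle (psum L low z (fun=> x)) (32 / L%:R ^+ 2 * nr x).
Proof.
apply: asle_bound; apply: filterS (@near_div_le R 1 1 ltr01) => p [p0 _].
have := @nr_psum R L L0 setT V low z (fun=> x) p (8 / L%:R * nr x) p0.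
move=> /(_ (fun q => low_arc (fun _ _ => I)))/(_ _)/le_trans; apply.
  move=> q j hq h1 h2; rewrite nrZ ler_wpM2r ?nr_ge0 //.
  exact: low_weight_le.
rewrite !big_cons big_nil /= le_eqVlt; apply/orP; left; apply/eqP.
have -> : (L - 1 - (L - 2) = 1)%N by lia.
have -> : (L - (L - 1) = 1)%N by lia.
rewrite subn0 (_ : (2 - 1 = 1)%N) //.
by field; rewrite pnatr_eq0 -lt0n.
Qed.

(** Two integrations by parts: the first has no boundary terms, the second leaves the jumps of the
    slopes. Four slopes of modulus 1, two endpoints each, divided by the lower bound 4 for [sigma],
    give the constant 2. *)
Lemma low_decay z :
  asle (fun p => ((z + 1 + 1) * (z + 1))%:~R *: psum L low z (fun=> x) p) (2 * nr x).
Proof.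
pose D : set R[i] := [set l | nr l = 1].
have D1 l : D l -> nr l = 1 by [].
have hs q : q \in low -> arc_in L D q.1.1 q.1.2 by exact: low_arc.
have hs' q : q \in slopes low -> arc_in L D q.1.1 q.1.2.
  by move=> /mapP[q' hq' ->]; exact: hs hq'.
have qx : qder D (fun=> x) (fun=> - 0 *: (0 : V)).
  by apply: qder_ext (qder_cst D x) => // l; rewrite scaler0.
have := psum_parts L0 D1 z hs qx; rewrite jump_low => /(asle_sigma L0 erefl).
rewrite nr0 mul0r => h1.
have := psum_parts L0 D1 (z + 1) hs' qx => /(asle_sigma L0 erefl) h2.
have hj : nr (jump L (slopes low) (z + 1 + 1) (fun=> x)) / 4 <= 2 * nr x.
  have := @nr_jump_slopes V (z + 1 + 1) (fun=> x) low (nr x).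
  move=> /(_ (fun _ _ => conj (lexx _) (lexx _))).
  rewrite !big_cons big_nil /= ?nrN nr1 nr_zeta nr_zetaV.
  lra.
have := asleD (asleZ (z + 1 + 1)%:~R h1) (asleN (asle_le hj h2)).
rewrite mulr0 add0r; apply: asle_near; apply: nearW => p.
rewrite psum_slopes2 !scale0r !subr0 addr0 scalerDr scalerA -intrM addrK.
by [].
Qed.

End Low.

End Weights.


(** * Repeated integration by parts for the high part *)

Section HighPart.
Variables (R : realType) (V : normedModType R[i]) (T : {linear V -> V}).
Variables (D : set R[i]) (S : R[i] -> {linear V -> V}) (mu : R) (h : nat).
Local Notation L := (h.*2).
Hypothesis h3 : (2 < h)%N.
Hypothesis D1 : forall l, D l -> nr l = 1.
Hypothesis mu0 : 0 <= mu.
Hypothesis SK : forall l x, D l -> S l (l *: x - T x) = x.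
Hypothesis KS : forall l x, D l -> l *: S l x - T (S l x) = x.
Hypothesis S_le : forall l x, D l -> nr (S l x) <= mu * nr x.
Hypothesis D_arc : arc_in L D 1 (L - 1).
Variable x : V.

Let L0 : (0 < L)%N. Proof. by rewrite double_gt0; case: (h) h3. Qed.

(* Riemann sums for (2 i pi)^-1 times the integrals of l^z R(l,T)^k W(l) x and
   l^z R(l,T)^k W'(l) x, where W is the weight [high]. *)
Definition hsum k z := psum L (high R h) z (fun l => iter k (S l) x).
Definition hslope k z := psum L (slopes (high R h)) z (fun l => iter k (S l) x).

Let harc q : q \in high R h -> arc_in L D q.1.1 q.1.2.
Proof. exact: high_arc. Qed.

Let sarc q : q \in slopes (high R h) -> arc_in L D q.1.1 q.1.2.
Proof. by move=> /mapP[q' hq' ->]; exact: harc hq'. Qed.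

Let itbd k l : D l -> nr (iter k (S l) x) <= mu ^+ k * nr x.
Proof. exact: nr_resolvent_iter. Qed.

Lemma hsum_step k z : asle (fun p =>
  (z + 1)%:~R *: hsum k z p + hslope k (z + 1) p - k%:R *: hsum k.+1 (z + 1) p) 0.
Proof.
have qG := qder_resolvent mu0 SK KS S_le k x.
have := psum_parts L0 D1 z harc qG.
by rewrite jump_high // => /(asle_sigma L0 erefl); rewrite nr0 mul0r.
Qed.

(** The slopes are discontinuous, so boundary terms survive: slopes of total modulus at most 2 + 1 +
    2, two endpoints each, over 4. *)
Lemma hslope_step k z : asle (fun p =>
  (z + 1)%:~R *: hslope k z p - k%:R *: hslope k.+1 (z + 1) p)
  (5 / 2 * (mu ^+ k * nr x)).
Proof.
have qG := qder_resolvent mu0 SK KS S_le k x.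
have := psum_parts L0 D1 z sarc qG => /(asle_sigma L0 erefl).
set c := nr _ / 4 => hc.
have {hc} : asle (fun p =>
  (z + 1)%:~R *: hslope k z p - k%:R *: hslope k.+1 (z + 1) p) c.
  by apply: asle_near hc; apply: nearW => p; rewrite psum_slopes2 addr0.
apply: asle_le; rewrite /c.
have hq q : q \in high R h ->
    nr (iter k (S (root R L 1 ^+ q.1.1)) x) <= mu ^+ k * nr x /\
    nr (iter k (S (root R L 1 ^+ q.1.2)) x) <= mu ^+ k * nr x.
  move=> /harc[uv hD]; split; apply: itbd; apply: hD => //; rewrite !mul1n ?uv !leqnn //.
have := @nr_jump_slopes R h V (z + 1) (fun l => iter k (S l) x) (high R h) _ hq.
have : forall q, q \in high R h -> nr q.2.1 <= 2 by exact: high_slope_le.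
move=> hs.
have : \sum_(q <- high R h) nr q.2.1 * (mu ^+ k * nr x + mu ^+ k * nr x) <=
    10 * (mu ^+ k * nr x).
  have t0 : 0 <= mu ^+ k * nr x by nneg.
  have s1 := hs _ (mem_nth ((0, 0)%N, (0, 0)) (isT : (0 < size (high R h))%N)).
  have s3 := hs _ (mem_nth ((0, 0)%N, (0, 0)) (isT : (2 < size (high R h))%N)).
  rewrite !big_cons big_nil /= in s1 s3 *; rewrite nr1.
  move: s1 s3 (nr_ge0 (1 + (root R L 1)^-1)) (nr_ge0 (1 + root R L 1)).
  move: (nr (1 + (root R L 1)^-1)) (nr (1 + root R L 1)) (mu ^+ k * nr x) t0.
  move=> u v w w0 *; nra.
lra.
Qed.

Lemma high_len (B : R) :
  \sum_(q <- high R h) (q.1.2 - q.1.1)%:R / L%:R * B = (L - 2)%:R / L%:R * B.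
Proof.
rewrite !big_cons big_nil /= addr0 -!mulrDl -!natrD; congr (_%:R / _ * _).
by have := h3; lia.
Qed.

Lemma high_len_le (B : R) : 0 <= B ->
  \sum_(q <- high R h) (q.1.2 - q.1.1)%:R / L%:R * B <= B.
Proof.
move=> B0; rewrite high_len -[leRHS]mul1r ler_wpM2r //.
by rewrite ler_pdivrMr ?ltr0n // mul1r ler_nat leq_subr.
Qed.

Lemma hsum_bound k z : asle (hsum k z) (4 * (mu ^+ k * nr x)).
Proof.
apply: asle_bound; apply: filterS (@near_div_le R 1 1 ltr01) => p [p0 _].
have B0 : 0 <= 4 * (mu ^+ k * nr x) by nneg.
apply: le_trans (high_len_le B0); apply: (nr_psum L0 _ p0 harc) => q j hq h1 h2.
have Dj : D (root R L p ^+ j) by have [_ hD] := harc hq; apply: hD => //; rewrite h1 ltnW.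
rewrite nrZ; apply: ler_pM; rewrite ?nr_ge0 //; last exact: itbd.
by apply: high_weight_le hq; rewrite nrX nr_root expr1n.
Qed.

Lemma hslope_bound k z : asle (hslope k z) (2 * (mu ^+ k * nr x)).
Proof.
apply: asle_bound; apply: filterS (@near_div_le R 1 1 ltr01) => p [p0 _].
have B0 : 0 <= 2 * (mu ^+ k * nr x) by nneg.
apply: le_trans (high_len_le B0).
have -> : \sum_(q <- high R h) (q.1.2 - q.1.1)%:R / L%:R * (2 * (mu ^+ k * nr x)) =
    \sum_(q <- slopes (high R h)) (q.1.2 - q.1.1)%:R / L%:R * (2 * (mu ^+ k * nr x)).
  by rewrite big_map.
apply: (nr_psum L0 _ p0 sarc) => q j /mapP[q' hq' ->] /= h1 h2.
have Dj : D (root R L p ^+ j) by have [_ hD] := harc hq'; apply: hD => //; rewrite h1 ltnW.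
rewrite mul0r add0r nrZ; apply: ler_pM; rewrite ?nr_ge0 //; last exact: itbd.
exact: high_slope_le hq'.
Qed.

Lemma asle_div (a : R[i]) (y : nat -> V) (c n : R) : 0 < n -> n <= nr a ->
  asle (fun p => a *: y p) c -> asle y (c / n).
Proof.
move=> n0 na hy e e0; have en : 0 < e * n by exact: mulr_gt0.
apply: filterS (hy _ en) => p; rewrite nrZ => hp.
have -> : c / n + e = (c + e * n) / n by field; rewrite gt_eqF.
rewrite ler_pdivlMr //; apply: le_trans hp; rewrite mulrC ler_wpM2r //.
exact: nr_ge0.
Qed.

Section Decay.
Variables (n : nat) (s : R) (kappa : nat).
Hypothesis n0 : (0 < n)%N.
Hypothesis s01 : 0 <= s < 1.
Hypothesis hkappa : kappa%:R * mu <= s * n%:R.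

Let r := mu / n%:R.
(** [B] and [A] are the fixed points of b = 5 / 2 + s b and a = B + s a, which govern the
    accumulated boundary terms below. *)
Let B := 5 / 2 / (1 - s).
Let A := B / (1 - s).
(** The factor gained by d integrations by parts that start from the k-th power of the resolvent. *)
Let P d k := \prod_(i < d) ((k + i)%:R * r).

Let nR0 : 0 < n%:R :> R. Proof. by rewrite ltr0n. Qed.

Let r0 : 0 <= r. Proof. exact: divr_ge0 mu0 (ltW nR0). Qed.

Let PS d k : P d.+1 k = k%:R * r * P d k.+1.
Proof.
rewrite /P big_ord_recl addn0; congr (_ * _); apply: eq_bigr => i _.
by rewrite /= /bump /= addnA addn1.
Qed.

Let P0 d k : 0 <= P d k.
Proof. by apply: prodr_ge0 => i _; rewrite mulr_ge0 ?ler0n. Qed.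

Let kr_le k : (k <= kappa)%N -> k%:R * r <= s.
Proof.
move=> hk; rewrite /r mulrA ler_pdivrMr //; apply: le_trans hkappa.
by rewrite ler_wpM2r // ler_nat.
Qed.

Let nr_z (z : int) : n%:Z <= z -> n%:R <= nr ((z + 1)%:~R : R[i]).
Proof.
move=> nz; rewrite nr_int (_ : n%:R = n%:~R) // ler_int; lia.
Qed.

Let X := nr x.

Let X0 : 0 <= X. Proof. exact: nr_ge0. Qed.

Let B0 : 0 <= B.
Proof. by have /andP[_ s1] := s01; rewrite /B !divr_ge0 //; lra. Qed.

Let A0 : 0 <= A.
Proof. by have /andP[_ s1] := s01; rewrite /A divr_ge0 //; lra. Qed.

Let BE : 5 / 2 + s * B = B.
Proof. by rewrite /B; field; have /andP[_ s1] := s01; rewrite gt_eqF // subr_gt0. Qed.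

Let AE : B + s * A = A.
Proof. by rewrite /A; field; have /andP[_ s1] := s01; rewrite gt_eqF // subr_gt0. Qed.

(** Induction from k = kappa, where the crude bound applies, down to smaller k. Each step divides by
    |z + 1| >= n and multiplies the previous bound by k r <= s, so that the boundary terms
    accumulate to [B] only. *)
Lemma hslope_decay d k z : (k + d = kappa)%N -> n%:Z <= z ->
  asle (hslope k z) (mu ^+ k * X * (B / n%:R + 2 * P d k)).
Proof.
elim: d k z => [|d ih] k z kd nz.
  apply: asle_le (hslope_bound k z); rewrite /P big_ord0 mulr1.
  have t0 : 0 <= mu ^+ k * X by nneg.
  rewrite -/X mulrC ler_wpM2l // lerDr divr_ge0 // ltW //.
have kd' : (k.+1 + d = kappa)%N by rewrite addSnnS.
have kk : (k <= kappa)%N by rewrite -kd leq_addr.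
have nz' : n%:Z <= z + 1 by rewrite (le_trans nz) // lerDl.
have h1 := ih k.+1 (z + 1) kd' nz'.
have := asleD (hslope_step k z) (asleZ k%:R h1).
rewrite nr_nat => hs.
have {}hs : asle (fun p => (z + 1)%:~R *: hslope k z p) (5 / 2 * (mu ^+ k * nr x) +
    k%:R * (mu ^+ k.+1 * X * (B / n%:R + 2 * P d k.+1))).
  by apply: asle_near hs; apply: nearW => p; rewrite subrK.
apply: asle_le (asle_div nR0 (nr_z nz) hs).
rewrite PS -/X exprS.
have -> : (5 / 2 * (mu ^+ k * X) + k%:R * (mu * mu ^+ k * X *
    (B / n%:R + 2 * P d k.+1))) / n%:R =
  mu ^+ k * X * ((5 / 2 + k%:R * r * B) / n%:R + 2 * (k%:R * r * P d k.+1)).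
  by rewrite /r; field; rewrite gt_eqF.
apply: ler_wpM2l; first by nneg.
rewrite lerD2r ler_pM2r ?invr_gt0 // -[leRHS]BE lerD2l ler_wpM2r // kr_le //.
Qed.

(** Same descent. Each step brings in one slope sum, already of size [B] / n plus a multiple of [P];
    the division by n leads to [A] / n^2 and to the term linear in d. *)
Lemma hsum_decay d k z : (k + d = kappa)%N -> n%:Z <= z ->
  asle (hsum k z)
    (mu ^+ k * X * (A / n%:R ^+ 2 + (4 + 2 * d%:R / n%:R) * P d k)).
Proof.
elim: d k z => [|d ih] k z kd nz.
  apply: asle_le (hsum_bound k z); rewrite /P big_ord0 !mulr1 mulr0 mul0r addr0.
  rewrite -/X mulrC; apply: ler_wpM2l; first by nneg.
  by rewrite lerDr divr_ge0 // exprn_ge0 // ltW.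
have kd' : (k.+1 + d = kappa)%N by rewrite addSnnS.
have kk : (k <= kappa)%N by rewrite -kd leq_addr.
have nz' : n%:Z <= z + 1 by rewrite (le_trans nz) // lerDl.
have h1 := ih k.+1 (z + 1) kd' nz'.
have h2 := hslope_decay (z := z + 1) kd nz'.
have := asleD (asleD (hsum_step k z) (asleN h2)) (asleZ k%:R h1).
rewrite nr_nat add0r => hs.
have {}hs : asle (fun p => (z + 1)%:~R *: hsum k z p)
   (mu ^+ k * X * (B / n%:R + 2 * P d.+1 k) +
    k%:R * (mu ^+ k.+1 * X * (A / n%:R ^+ 2 + (4 + 2 * d%:R / n%:R) * P d k.+1))).
  by apply: asle_near hs; apply: nearW => p; rewrite addrAC subrK addrK.
apply: asle_le (asle_div nR0 (nr_z nz) hs).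
rewrite PS -/X exprS.
have -> : (mu ^+ k * X * (B / n%:R + 2 * (k%:R * r * P d k.+1)) +
    k%:R * (mu * mu ^+ k * X *
    (A / n%:R ^+ 2 + (4 + 2 * d%:R / n%:R) * P d k.+1))) / n%:R =
  mu ^+ k * X * ((B + k%:R * r * A) / n%:R ^+ 2 +
     (4 + 2 * (d%:R + 1) / n%:R) * (k%:R * r * P d k.+1)).
  by rewrite /r; field; rewrite gt_eqF.
apply: ler_wpM2l; first by nneg.
rewrite natr1 lerD2r ler_pM2r ?invr_gt0 ?exprn_gt0 // -[leRHS]AE lerD2l.
by rewrite ler_wpM2r // kr_le //.
Qed.

End Decay.

(** A single integration by parts, valid at negative frequencies too; it makes the remainder in the
    iterated shift relation negligible. *)
Lemma hsum_far z : z + 1 != 0 -> asle (hsum 1 z)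
  ((4 * mu ^+ 2 + 2 * mu) * nr x / `|z + 1|%:~R).
Proof.
move=> z0.
have := asleD (asleD (hsum_step 1 z) (asleN (hslope_bound 1 (z + 1))))
  (asleZ 1 (hsum_bound 2 (z + 1))).
rewrite nr1 add0r mul1r expr1 => hs.
have {}hs : asle (fun p => (z + 1)%:~R *: hsum 1 z p)
    (2 * (mu * nr x) + 4 * (mu ^+ 2 * nr x)).
  apply: asle_near hs; apply: nearW => p.
  by rewrite addrAC subrK addrK.
have n1 : 0 < `|z + 1|%:~R :> R by rewrite ltr0z normr_gt0.
apply: asle_le (asle_div n1 _ hs); last by rewrite nr_int.
by rewrite le_eqVlt; apply/orP; left; apply/eqP; congr (_ / _); ring.
Qed.

End HighPart.


(** * Orthogonality of the roots of unity *)

Section FullWeight.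
Variables (R : realType) (V : normedModType R[i]) (L : nat).
Hypothesis L0 : (0 < L)%N.

Lemma rsum_cat (f : R[i] -> V) u v w p : (u <= v <= w)%N ->
  rsum L f u v p + rsum L f v w p = rsum L f u w p.
Proof.
case/andP=> uv vw; rewrite /rsum -scalerDr; congr (_ *: _).
by rewrite [RHS](big_cat_nat (n := (p * v)%N)) ?leq_mul2l ?uv ?vw ?orbT.
Qed.

Lemma rsum_termD z (c c' : R[i] * R[i]) (G : R[i] -> V) u v p :
  rsum L (term z c G) u v p + rsum L (term z c' G) u v p =
  rsum L (term z (c.1 + c'.1, c.2 + c'.2) G) u v p.
Proof.
rewrite -rsumD; congr (rsum _ _ _ _ _); apply/funext => l.
by rewrite /term /= -scalerDr -scalerDl; congr (_ *: (_ *: _)); ring.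
Qed.

Lemma root_expn_neq1 p n : (0 < n)%N -> (n.*2 <= p * L)%N -> root R L p ^+ n != 1.
Proof.
move=> n0 np; have pL : (0 < p * L)%N by lia.
have p0 : (0 < p)%N by move: pL; rewrite muln_gt0 => /andP[].
rewrite root_exp //; apply: expi_neq1.
have pi0 : 0 < pi :> R by have := pi_ge2 R; lra.
rewrite ger0_norm; last by rewrite !mulr_ge0 ?invr_ge0 ?ler0n // ltW.
rewrite !mulr_gt0 ?invr_gt0 ?ltr0n //= mulrAC ger_pMl //.
by rewrite mulrA ler_pdivrMr ?ltr0n // mul1r -natrM ler_nat mul2n.
Qed.

Lemma root_expz_neq1 p (y : int) : y != 0 -> (`|y|.*2 <= p * L)%N ->
  root R L p ^ y != 1.
Proof.
case: y => n y0 np; first by apply: root_expn_neq1 => //; rewrite lt0n.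
by rewrite /exprz invr_eq1; exact: root_expn_neq1.
Qed.

(** A geometric sum; the bound on |y| excludes the nonzero multiples of p L. *)
Lemma sum_root p (y : int) : (0 < p)%N -> (`|y|.*2 <= p * L)%N ->
  \sum_(0 <= j < p * L) (root R L p ^+ j) ^ y = ((p * L)%:R * (y == 0)%:R).
Proof.
move=> p0 np.
have e j : (root R L p ^+ j) ^ y = (root R L p ^ y) ^+ j.
  by rewrite -[RHS]/((root R L p ^ y) ^ j%:Z) -[in LHS]/((root R L p ^ j%:Z) ^ y) exprzAC.
under eq_bigr do rewrite e.
have [->|y0] := eqVneq y 0.
  under eq_bigr do rewrite expr0z expr1n.
  by rewrite sumr_const_nat subn0 mulr1.
have := subrX1 (root R L p ^ y) (p * L).
rewrite -e root_period // exp1rz subrr => /esym/eqP.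
rewrite mulf_eq0 subr_eq0 (negbTE (root_expz_neq1 y0 np)) /= => /eqP s0.
by rewrite big_mkord s0 mulr0.
Qed.

(** The factor l built into the Riemann sum turns l^z (l - 1) into l^(z+2) - l^(z+1). The evaluation
    is exact once p is large. *)
Lemma rsum_full (x : V) (z : int) p : (0 < p)%N ->
  (`|(z + 2)%R|.*2 <= p * L)%N -> (`|(z + 1)%R|.*2 <= p * L)%N ->
  rsum L (term z (1, -1) (fun=> x)) 0 L p =
  ((z + 2 == 0)%:R - (z + 1 == 0)%:R) *: x.
Proof.
move=> p0 h2 h1; rewrite /rsum muln0.
have N0 : (p * L)%:R != 0 :> R[i] by rewrite pnatr_eq0 -lt0n muln_gt0 p0.
transitivity ((p * L)%:R^-1 *: ((\sum_(0 <= j < p * L) (root R L p ^+ j) ^ (z + 2) -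
    \sum_(0 <= j < p * L) (root R L p ^+ j) ^ (z + 1)) *: x)).
  congr (_ *: _); rewrite -sumrB scaler_suml; apply: eq_bigr => j _.
  rewrite /term /= !scalerA; congr (_ *: _).
  have w0 : root R L p ^+ j != 0 by rewrite expf_neq0 // root_neq0.
  rewrite (_ : z + 2 = 1 + (1 + z)); last by lia.
  rewrite [z + 1]addrC !expfzDr // !expr1z.
  by move: (root R L p ^+ j) (_ ^ z) => a b; ring.
by rewrite !sum_root // -mulrBr scalerA mulrA mulVf // mul1r.
Qed.

End FullWeight.

(** * Decomposition of the powers of the operator *)

Section Core.
Variables (R : realType) (V : normedModType R[i]) (T : {linear V -> V}).
Variables (D : set R[i]) (S : R[i] -> {linear V -> V}) (mu M : R) (h : nat).
Local Notation L := (h.*2).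
Hypothesis h3 : (2 < h)%N.
Hypothesis D1 : forall l, D l -> nr l = 1.
Hypothesis mu0 : 0 <= mu.
Hypothesis SK : forall l x, D l -> S l (l *: x - T x) = x.
Hypothesis KS : forall l x, D l -> l *: S l x - T (S l x) = x.
Hypothesis S_le : forall l x, D l -> nr (S l x) <= mu * nr x.
Hypothesis D_arc : arc_in L D 1 (L - 1).
Hypothesis M0 : 0 <= M.
Hypothesis T_le : forall n x, nr (iter n T x) <= M * nr x.
Variable x : V.

Let L0 : (0 < L)%N. Proof. by rewrite double_gt0; case: (h) h3. Qed.

Local Notation lsum z := (psum L (low R h) z (fun=> x)).
Local Notation hsum := (hsum S h x).

Let iterD k : {morph iter k T : y y' / y + y'}.
Proof. by elim: k => [|k ih] y y' //=; rewrite ih linearD. Qed.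

Let iterZ k a y : iter k T (a *: y) = a *: iter k T y.
Proof. by elim: k => [|k ih] //=; rewrite ih linearZ. Qed.

(** On the two arcs where both weights live, their affine coefficients add up to those of l - 1. *)
Lemma low_high_sum z p : lsum z p + hsum 0 z p = rsum L (term z (1, -1) (fun=> x)) 0 L p.
Proof.
rewrite /hsum /psum !big_cons !big_nil /= !addr0.
have hL : (2 < L)%N by lia.
set W := term z (1, -1) (fun=> x).
have e1 := @rsum_termD R V L z (- (root R L 1)^-1, root R L 1)
  (1 + (root R L 1)^-1, - (root R L 1 + 1)) (fun=> x) 1 2 p.
have e2 := @rsum_termD R V L z (- root R L 1, (root R L 1)^-1)
  (1 + root R L 1, - ((root R L 1)^-1 + 1)) (fun=> x) (L - 2) (L - 1) p.
rewrite /= in e1 e2.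
rewrite (_ : - (root R L 1)^-1 + (1 + (root R L 1)^-1) = 1) in e1; last by ring.
rewrite (_ : root R L 1 - (root R L 1 + 1) = -1) in e1; last by ring.
rewrite (_ : - root R L 1 + (1 + root R L 1) = 1) in e2; last by ring.
rewrite (_ : (root R L 1)^-1 - ((root R L 1)^-1 + 1) = -1) in e2; last by ring.
have c1 : rsum L W 0 1 p + rsum L W 1 2 p = rsum L W 0 2 p by rewrite rsum_cat.
have c2 : rsum L W 0 2 p + rsum L W 2 (L - 2) p = rsum L W 0 (L - 2) p.
  by rewrite rsum_cat //; lia.
have c3 : rsum L W 0 (L - 2) p + rsum L W (L - 2) (L - 1) p = rsum L W 0 (L - 1) p.
  by rewrite rsum_cat //; lia.
have c4 : rsum L W 0 (L - 1) p + rsum L W (L - 1) L p = rsum L W 0 L p.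
  by rewrite rsum_cat //; lia.
rewrite -c4 -c3 -c2 -c1 -/W in e1 e2 *; rewrite -e1 -e2.
move: (rsum _ _ _ _ _) (rsum _ _ _ _ _) (rsum _ _ _ _ _) (rsum _ _ _ _ _) => a1 a2 a3 a4.
move: (rsum _ _ _ _ _) (rsum _ _ _ _ _) (rsum _ _ _ _ _) => a5 a6 a7.
by lmodule.
Qed.

(** Holds exactly because l R(l,T) = T R(l,T) + 1 at each sample point. *)
Lemma hsum_shift z p : (0 < p)%N ->
  hsum 1 (z + 1) p = T (hsum 1 z p) + hsum 0 z p.
Proof.
move=> p0; rewrite /hsum /psum linear_sum -big_split /=.
rewrite big_seq [RHS]big_seq; apply: eq_bigr => q hq.
have [_ hD] := high_arc h3 D_arc hq.
rewrite /rsum linearZ -scalerDr /=; congr (_ *: _).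
rewrite linear_sum -big_split /=; apply: eq_big_nat => j /andP[h1 h2].
have Dl : D (root R L p ^+ j) by apply: hD => //; rewrite h1 ltnW.
have l0 : root R L p ^+ j != 0 by rewrite expf_neq0 // root_neq0.
rewrite /term expfzDr // expr1z !linearZ /=.
move: (root R L p ^+ j) Dl {l0} => l Dl; have e := KS x Dl.
have e' : T (S l x) = l *: S l x - x by move/eqP: e; rewrite subr_eq => /eqP->; rewrite addrAC subrr add0r.
rewrite e'; move: (l ^ z) => lz; by lmodule.
Qed.

Lemma hsum_iter k z p : (0 < p)%N -> hsum 1 z p =
  iter k T (hsum 1 (z - k%:Z) p) + \sum_(j < k) iter j T (hsum 0 (z - 1 - j%:Z) p).
Proof.
move=> p0; elim: k => [|k ih]; first by rewrite big_ord0 addr0 subr0.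
rewrite big_ord_recr /= {1}ih.
have -> : z - k%:Z = (z - k.+1%:Z) + 1 by lia.
rewrite hsum_shift // iterD -iterSr /= -!addrA; congr (_ + _).
rewrite addrC; congr (_ + iter k T (hsum 0 _ _)); lia.
Qed.

(** Discrete replacement for the Cauchy integral of T^n (T - 1). After k shifts the low and high
    sums at frequency n - 1 - j combine to the full weight, whose sum is x for j = n + 1, - x for j
    = n and 0 otherwise. *)
Lemma power_identity n k p : (n.+1 < k)%N -> ((n + k).+1.*2 <= p)%N ->
  iter n.+1 T x - iter n T x =
  \sum_(j < k) iter j T (lsum (n%:Z - 1 - j%:Z) p) + hsum 1 n%:Z p
  - iter k T (hsum 1 (n%:Z - k%:Z) p).
Proof.
move=> nk kp; have p0 : (0 < p)%N by lia.
have assoc (a b c : V) : a + (b + c) - b = a + c by lmodule.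
rewrite (hsum_iter k n%:Z p0) assoc.
have -> : \sum_(j < k) iter j T (lsum (n%:Z - 1 - j%:Z) p) +
    (\sum_(j < k) iter j T (hsum 0 (n%:Z - 1 - j%:Z) p)) =
  \sum_(j < k) ((j == n.+1 :> nat)%:R - (j == n :> nat)%:R) *: iter j T x.
  rewrite -big_split /=; apply: eq_bigr => j _; have jk := ltn_ord j.
  rewrite -iterD low_high_sum rsum_full //; last 2 first.
  - by apply: leq_trans (leq_pmulr p L0); apply: leq_trans kp; lia.
  - by apply: leq_trans (leq_pmulr p L0); apply: leq_trans kp; lia.
  rewrite iterZ; congr ((_%:R - _%:R) *: _); congr nat_of_bool; lia.
have pick m : (m < k)%N ->
    \sum_(j < k) (j == m :> nat)%:R *: iter j T x = iter m T x.
  move=> mk; rewrite (bigD1 (Ordinal mk)) //= eqxx scale1r big1 ?addr0 // => j.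
  by move/negbTE; rewrite -val_eqE /= => ->; rewrite scale0r.
under eq_bigr do rewrite scalerBl.
by rewrite sumrB !pick //; lia.
Qed.

(** Merges two competing bounds into one rational expression in place of a minimum. *)
Lemma asle_weighted (y : nat -> V) (a : R[i]) (b1 b2 u v : R) :
  0 <= u -> 0 <= v -> 0 < u + v * nr a ->
  asle y b1 -> asle (fun p => a *: y p) b2 ->
  asle y ((u * b1 + v * b2) / (u + v * nr a)).
Proof.
move=> u0 v0 d0 h1 h2 e e0.
have e1 : 0 < e * (u + v * nr a) / (u + v + 1).
  by rewrite divr_gt0 ?mulr_gt0 //; lra.
apply: filterS2 (h1 _ e1) (h2 _ e1) => p hp1 hp2; rewrite nrZ in hp2.
set d := u + v * nr a in d0 e1 hp1 hp2 *.
have -> : (u * b1 + v * b2) / d + e = (u * b1 + v * b2 + e * d) / d.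
  by field; rewrite gt_eqF.
rewrite ler_pdivlMr //.
have w1 := ler_wpM2l u0 hp1; have w2 := ler_wpM2l v0 hp2.
have w3 : (u + v) * (e * d / (u + v + 1)) <= e * d.
  rewrite mulrA ler_pdivrMr; last lra.
  by rewrite mulrC ler_wpM2l ?mulr_ge0 ?ltW //; lra.
have -> : nr (y p) * d = u * nr (y p) + v * (nr a * nr (y p)) by rewrite /d; ring.
lra.
Qed.

(* Increments of [majorant] dominate [lsum], so that summing over all
   frequencies telescopes. *)
Definition majorant (i : int) : R := 100 / L%:R * (i%:~R / (L%:R + `|i|%:~R)).

Lemma majorant_diff (i : nat) :
  majorant (i%:Z + 1) - majorant i%:Z = 100 / ((L%:R + i%:R) * (L%:R + i%:R + 1)).
Proof.
rewrite /majorant !ger0_norm ?addr_ge0 //.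
rewrite intrD -!pmulrn; field.
have l0 : 0 < L%:R :> R by rewrite ltr0n.
have i0 : 0 <= i%:R :> R by rewrite ler0n.
by rewrite !gt_eqF //; lra.
Qed.

Lemma majorantN i : majorant (- i) = - majorant i.
Proof. by rewrite /majorant normrN mulrNz mulNr mulrN. Qed.

Lemma majorant_le i : `|majorant i| <= 100 / L%:R.
Proof.
have l0 : 0 < L%:R :> R by rewrite ltr0n.
rewrite /majorant normrM ger0_norm ?divr_ge0 ?ler0n // -[leRHS]mulr1.
rewrite ler_wpM2l ?divr_ge0 ?ler0n // normrM normfV -intr_norm.
have d0 : 0 < L%:R + `|i|%:~R :> R by rewrite ltr_wpDr // ler0z.
by rewrite (gtr0_norm d0) ler_pdivrMr // mul1r lerDr ltW.
Qed.

(** The weights 3 L^2 and 2 give the numerator 3 * 32 + 2 * 2 = 100, and 3 L^2 + 2 i (i + 1) exceeds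
    (L + i) (L + i + 1) by (L - i)^2 + L^2 - L + i. *)
Lemma lsum_nat_le (z : int) (i : nat) : `|(z + 2) * (z + 1)| = (i * i.+1)%N%:Z ->
  asle (lsum z) ((majorant (i%:Z + 1) - majorant i%:Z) * nr x).
Proof.
move=> zi; have l0 : 0 < L%:R :> R by rewrite ltr0n.
have l1 : 1 <= L%:R :> R by rewrite ler1n.
have i0 : 0 <= i%:R :> R by rewrite ler0n.
have hi : nr (((z + 1 + 1) * (z + 1))%:~R : R[i]) = i%:R * (i%:R + 1).
  by rewrite nr_int -addrA zi -pmulrn natrM natr1.
have := @asle_weighted _ _ _ _ (3 * L%:R ^+ 2) 2 _ _ _
  (low_small h3 x z) (low_decay h3 x z).
rewrite hi; have t0 : 0 <= i%:R * (i%:R + 1) :> R by rewrite mulr_ge0 //; lra.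
have q0 : 0 < L%:R ^+ 2 :> R by rewrite exprn_gt0.
move=> /(_ _ _ _)/asle_le; apply; try lra.
rewrite majorant_diff.
have -> : 3 * L%:R ^+ 2 * (32 / L%:R ^+ 2 * nr x) + 2 * (2 * nr x) = 100 * nr x.
  by field; rewrite gt_eqF.
rewrite [leRHS]mulrAC ler_wpM2l ?mulr_ge0 ?nr_ge0 //.
rewrite lef_pV2 ?posrE.
- have := sqr_ge0 (L%:R - i%:R : R); have := ler_wpM2l (ltW l0) l1; lra.
- lra.
- by rewrite mulr_gt0 //; lra.
Qed.

Lemma lsum_le (i : int) :
  asle (lsum (i - 1)) ((majorant (i + 1) - majorant i) * nr x).
Proof.
case: i => i.
  apply: lsum_nat_le.
  rewrite (_ : (i%:Z - 1 + 2) * (i%:Z - 1 + 1) = (i * i.+1)%N%:Z) //; lia.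
(* The majorant is odd, so its increments are symmetric and negative i reduces to the previous
   case. *)
have -> : majorant (Negz i + 1) - majorant (Negz i) = majorant (i%:Z + 1) - majorant i%:Z.
  rewrite (_ : Negz i + 1 = - i%:Z); last lia.
  rewrite (_ : Negz i = - (i%:Z + 1)); last lia.
  by rewrite !majorantN opprK addrC.
apply: lsum_nat_le.
rewrite (_ : (Negz i - 1 + 2) * (Negz i - 1 + 1) = (i * i.+1)%N%:Z) //; lia.
Qed.

(** Power-boundedness handles each T^j; the majorants telescope to at most twice 100 / L, whatever
    the number k of terms. *)
Lemma lsum_series_le n k : asle (fun p =>
  \sum_(j < k) iter j T (lsum (n%:Z - 1 - j%:Z) p)) (M * (200 / L%:R * nr x)).
Proof.
have := asle_sum (index_enum 'I_k) (fun j : 'I_k =>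
  asle_map M0 (T_le (val j)) (lsum_le (n%:Z - j%:Z))).
rewrite (eq_bigr (fun j : 'I_k => M * nr x *
  (majorant (n%:Z - j%:Z + 1) - majorant (n%:Z - j%:Z)))); last first.
  by move=> j _; rewrite mulrA mulrAC.
rewrite -mulr_sumr.
have -> : \sum_(j < k) (majorant (n%:Z - j%:Z + 1) - majorant (n%:Z - j%:Z)) =
    majorant (n%:Z + 1) - majorant (n%:Z + 1 - k%:Z).
  elim: k => [|k ih]; first by rewrite big_ord0 subr0 subrr.
  rewrite big_ord_recr /= ih (_ : n%:Z - k%:Z + 1 = n%:Z + 1 - k%:Z); last lia.
  rewrite (_ : n%:Z - k%:Z = n%:Z + 1 - k.+1%:Z); last lia.
  by rewrite addrA subrK.
move=> hs; have {}hs : asle (fun p =>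
    \sum_(j < k) iter j T (lsum (n%:Z - 1 - j%:Z) p))
    (M * nr x * (majorant (n%:Z + 1) - majorant (n%:Z + 1 - k%:Z))).
  apply: asle_near hs; apply: nearW => p; apply: eq_bigr => j _.
  by rewrite addrAC.
apply: asle_le hs; rewrite -mulrA ler_wpM2l // mulrC ler_wpM2r ?nr_ge0 //.
have := majorant_le (n%:Z + 1); have := majorant_le (n%:Z + 1 - k%:Z).
by rewrite !ler_norml => /andP[a1 a2] /andP[b1 b2]; lra.
Qed.

Lemma power_diff_le n (alpha : R) : asle (hsum 1 n%:Z) alpha ->
  nr (iter n.+1 T x - iter n T x) <= M * (200 / L%:R * nr x) + alpha.
Proof.
move=> ha; apply/ler_addgt0Pr => e e0.
pose C := M * ((4 * mu ^+ 2 + 2 * mu) * nr x).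
have [N _ hN] := @near_div_le R C e e0.
have [N0 hNe] := hN N.+1 (leqnSn N : [set n | (N <= n)%N] N.+1).
(* Then n - k + 1 = - (N + 1), so the far term is at most C / (N + 1) <= e. *)
pose k := (n.+2 + N)%N.
have zk : n%:Z - k%:Z + 1 = - N.+1%:Z by rewrite /k; lia.
have z0 : n%:Z - k%:Z + 1 != 0 by rewrite zk oppr_eq0.
have hf := hsum_far h3 D1 mu0 SK KS S_le D_arc x z0.
have := asleD (asleD (lsum_series_le n k) ha) (asleN (asle_map M0 (T_le k) hf)).
move=> hs; apply: (@asle_cst _ _ _ _).
apply: asle_le (asle_near _ hs).
  rewrite lerD2l zk normrN ger0_norm // -pmulrn.
  by apply: le_trans hNe; rewrite /C mulrA.
exists (n + k).+1.*2 => // p /= kp.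
by rewrite -(power_identity _ kp) // /k; lia.
Qed.

End Core.

(** * Factorials against exponentials *)

Section Numerics.
Variable R : realType.
Implicit Types (r s t : R) (d : nat).

(** A weak Stirling bound; the induction step is (1 - 1 / (d + 2))^(d + 2) <= exp(-1). *)
Lemma fact_expR_le d : d`!%:R <= d.+1%:R ^+ d.+1 * expR (- d%:R) :> R.
Proof.
elim: d => [|d ih]; first by rewrite oppr0 expR0 expr1n mulr1.
have a0 : 0 < d.+1%:R :> R by rewrite ltr0n.
have b0 : 0 < d.+2%:R :> R by rewrite ltr0n.
rewrite factS natrM; apply: le_trans (ler_wpM2l (ltW a0) ih) _.
have -> : - d.+1%:R = - d%:R - 1 :> R by rewrite -natr1; ring.
have -> : d.+1%:R * (d.+1%:R ^+ d.+1 * expR (- d%:R)) = expR (- d%:R) * d.+1%:R ^+ d.+2 :> R.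
  by rewrite (exprS _ d.+1); ring.
rewrite expRD [leRHS]mulrCA ler_wpM2l ?expR_ge0 //.
have h : d.+1%:R / d.+2%:R <= expR (- (d.+2%:R)^-1) :> R.
  apply: le_trans (expR_ge1Dx _); rewrite -[in leLHS](addrK 1 d.+1%:R) natr1.
  by rewrite mulrBl mul1r divff ?gt_eqF.
have h2 : (d.+1%:R / d.+2%:R) ^+ d.+2 <= expR (-1) :> R.
  apply: le_trans (_ : expR (- (d.+2%:R)^-1) ^+ d.+2 <= _).
    by rewrite lerXn2r ?nnegrE ?expR_ge0 // divr_ge0 // ltW.
  by rewrite -expRM_natl mulrN divff ?gt_eqF.
by rewrite [leRHS]mulrC -ler_pdivrMr ?exprn_gt0 // -expr_div_n.
Qed.

(** Since s < 1, the left side is at most the geometric sum 1 + s + ... + s^d. *)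
Lemma natr_expr_le s d : 0 <= s < 1 -> d.+1%:R * s ^+ d <= (1 - s)^-1.
Proof.
case/andP=> s0 s1; have d0 : 0 < 1 - s by lra.
rewrite -[leRHS]mul1r ler_pdivlMr //.
have : d.+1%:R * s ^+ d * (1 - s) + s ^+ d.+1 <= 1.
  elim: d => [|d ih]; first by rewrite expr0 expr1; lra.
  have e0 : 0 <= s ^+ d.+1 by exact: exprn_ge0.
  have e1 : s ^+ d.+1 <= 1 by rewrite exprn_ile1 // ltW.
  have := ler_wpM2l s0 ih.
  have := ler_wpM2r (ltW d0) e1.
  rewrite -(natr1 d.+1) !(exprS s d.+1) (exprS s d).
  by move: (s ^+ d) (d.+1%:R) => u v; lra.
by have := exprn_ge0 d.+1 s0; lra.
Qed.

(** The product is d! r^d with r <= s / (d + 1). The Stirling bound leaves exp(-d) (d + 1) s^d, and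
    the strict inequality s < 1 absorbs the factor d + 1. *)
Lemma prod_natr_le r s d : 0 <= s < 1 -> 0 <= r -> d.+1%:R * r <= s ->
  \prod_(i < d) ((1 + i)%:R * r) <= expR (- d%:R) / (1 - s).
Proof.
move=> s01 r0 rs; have /andP[s0 s1] := s01.
have a0 : 0 < d.+1%:R :> R by rewrite ltr0n.
have -> : \prod_(i < d) ((1 + i)%:R * r) = d`!%:R * r ^+ d.
  rewrite big_split /= prodr_const card_ord; congr (_ * _).
  rewrite fact_prod -natr_prod; congr (_%:R).
  rewrite big_add1 /= big_mkord; apply: eq_bigr => i _; exact: add1n.
apply: le_trans (_ : d.+1%:R ^+ d.+1 * expR (- d%:R) * (s / d.+1%:R) ^+ d <= _).
  apply: ler_pM; rewrite ?ler0n ?exprn_ge0 ?fact_expR_le //.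
  rewrite lerXn2r ?nnegrE //; first by rewrite divr_ge0 // ltW.
  by rewrite ler_pdivlMr // mulrC.
have -> : d.+1%:R ^+ d.+1 * expR (- d%:R) * (s / d.+1%:R) ^+ d =
    expR (- d%:R) * (d.+1%:R * s ^+ d).
  rewrite expr_div_n exprS; field.
  by rewrite expf_neq0 // gt_eqF.
by rewrite ler_wpM2l ?expR_ge0 ?natr_expr_le.
Qed.

End Numerics.

(** * Inverting the function [m_log] *)

Section MLog.
Variables (R : realType) (m : R -> R).
Hypothesis m_cont : {within `]0, pi], continuous m}.
Hypothesis m_anti : forall x y : R, 0 < x -> x <= y -> y <= pi -> m y <= m x.
Hypothesis m_gt0 : forall t : R, 0 < t <= pi -> 0 < m t.

Lemma m_log_anti x y : 0 < x -> x <= y -> y <= pi -> m_log m y <= m_log m x.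
Proof.
move=> x0 xy yp; have y0 := lt_le_trans x0 xy.
have my : 0 < m y by apply: m_gt0; rewrite y0.
have hm := m_anti x0 xy yp.
have mx := lt_le_trans my hm.
have d : m y / y <= m x / x by rewrite ler_pM ?invr_ge0 ?lef_pV2 ?posrE // ltW.
have dy : 0 < m y / y by exact: divr_gt0.
rewrite /m_log; apply: ler_pM => //; [exact: ltW|by apply: ln_ge0; lra|].
by rewrite ler_ln ?posrE; lra.
Qed.

Lemma m_log_cont a b : 0 < a -> b <= pi -> {within `[a, b], continuous (m_log m)}.
Proof.
move=> a0 bp.
have sub : `[a, b] `<=` `]0, pi].
  move=> x /=; rewrite !in_itv /= => /andP[ax xb].
  by rewrite (lt_le_trans a0 ax) (le_trans xb bp).
have /subspace_continuousP hm := continuous_subspaceW sub m_cont.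
apply/subspace_continuousP => x Ax.
have /= := sub _ Ax; rewrite in_itv /= => /andP[x0 xp].
have hx := hm x Ax.
have mx : 0 < m x by apply: m_gt0; rewrite x0.
have q : 0 < m x / x by exact: divr_gt0.
have hid : id @ within `[a, b] (nbhs x) --> x by exact: cvg_within.
have hq : (fun y => 1 + m y / y) @ within `[a, b] (nbhs x) --> 1 + m x / x.
  apply: cvgD; first exact: cvg_cst.
  apply: cvgM hx _; apply: cvgV hid; exact: lt0r_neq0.
apply: cvgM hx _; apply: cvg_comp hq _.
by apply: continuous_ln; lra.
Qed.

(** Intermediate values: [m_log] is continuous and exceeds w close enough to 0. The t found is the
    value of the inverse at w. *)
Lemma m_log_onto (b w : R) : 0 < b <= pi -> m_log m b <= w ->
  exists2 t, 0 < t <= b & m_log m t = w.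
Proof.
case/andP=> b0 bp hw.
have pi0 : 0 < pi :> R := lt_le_trans b0 bp.
have m0 : 0 < m pi by apply: m_gt0; rewrite pi0 lexx.
(* For a <= a0 one has m a / a >= m pi / a0 = exp(w / m pi), whence m_log m a >= w. *)
pose a0 := m pi / expR (w / m pi).
have a00 : 0 < a0 by rewrite divr_gt0 ?expR_gt0.
pose a := Num.min a0 b.
have a_gt0 : 0 < a by rewrite lt_min a00.
have ab : a <= b by rewrite ge_min lexx orbT.
have wa : w <= m_log m a.
  apply: le_trans (_ : m_log m (Num.min a0 pi) <= _); last first.
    apply: m_log_anti => //; last by rewrite ge_min lexx orbT.
    by rewrite le_min ge_min lexx /= (le_trans ab bp).
  set a1 := Num.min a0 pi.
  have a10 : 0 < a1 by rewrite lt_min a00.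
  have a1p : a1 <= pi by rewrite ge_min lexx orbT.
  have mm := m_anti a10 a1p (lexx _).
  have h1 : m pi * (w / m pi) <= m pi * ln (1 + m a1 / a1).
    rewrite (ler_wpM2l (ltW m0)) // -ler_expR lnK; last first.
      rewrite posrE; have : 0 < m a1 / a1 by rewrite divr_gt0 // (lt_le_trans m0).
      lra.
    have : expR (w / m pi) <= m a1 / a1.
      rewrite ler_pdivlMr //.
      apply: le_trans (_ : expR (w / m pi) * a0 <= _).
        by rewrite ler_wpM2l ?expR_ge0 // ge_min lexx.
      by rewrite /a0 mulrCA divff ?mulr1 // gt_eqF // expR_gt0.
    lra.
  rewrite mulrCA divff ?mulr1 ?gt_eqF // in h1.
  apply: le_trans h1 _; rewrite /m_log ler_wpM2r // ln_ge0 // lerDl divr_ge0 // ltW //.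
  exact: lt_le_trans mm.
have [|t] := @IVT R (m_log m) a b w ab (m_log_cont a_gt0 bp).
  by rewrite ge_min hw orbT le_max wa.
rewrite in_itv /= => /andP[at_ tb] ht.
by exists t => //; rewrite tb (lt_le_trans a_gt0).
Qed.

End MLog.

(** * Growth of the resolvent at the spectral point 1 *)

Section ResolventGrowth.
Variables (R : realType) (V : completeNormedModType R[i]) (T : {linear V -> V}).

(** Neumann series for k - T = (1 - (l - k) S) (l - T), where S inverts l - T. *)
Lemma resolvent_perturbation (l k : R[i]) (S : {linear V -> V}) (mu : R) :
  continuous S -> is_inverse S (shift_op l T) -> (forall x, nr (S x) <= mu * nr x) ->
  nr (l - k) * mu < 1 -> 0 <= mu -> in_resolvent_set T k.
Proof.
move=> cS [SK KS] S_le q1 mu0; rewrite /shift_op in SK KS.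
pose A : {linear V -> V} := (l - k) \*: S.
have AE x : A x = (l - k) *: S x by [].
have [|x|G [cG GK KG]] := @neumann R V A (nr (l - k) * mu).
- by rewrite mulr_ge0 ?nr_ge0.
- by rewrite AE nrZ -mulrA ler_wpM2l ?nr_ge0.
exists (S \o G); split=> [x|].
  by apply: continuous_comp; [exact: cG|exact: cS].
split=> x; rewrite /shift_op /=.
- have -> : k *: x - T x = (l *: x - T x) - A (l *: x - T x).
    by rewrite AE SK; lmodule.
  by rewrite GK SK.
- transitivity (G x - A (G x)); last exact: KG.
  have -> : G x - A (G x) =
      (l *: S (G x) - T (S (G x))) - (l - k) *: S (G x) by rewrite KS AE.
  by lmodule.
Qed.

End ResolventGrowth.

Section Resolvents.
Variables (R : realType) (V : completeNormedModType R[i]) (T : {linear V -> V}).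
Variable m : R -> R.
Hypothesis spT : spectrum T `&` @unit_circle R = [set 1].
Hypothesis m_gt0 : forall t : R, 0 < t <= pi -> 0 < m t.
Hypothesis m_res : forall t : R, 0 < `|t| <= pi ->
  forall S : V -> V, is_inverse S (shift_op (expi t) T) -> op_norm_le S (m `|t|).

Lemma expi_resolvent t : 0 < `|t| <= pi -> in_resolvent_set T (expi t).
Proof.
move=> ht; apply: contrapT => nr1; have : [set 1] (expi t).
  by rewrite -spT; split=> //; rewrite /unit_circle /= -nrE nr_expi.
by move/eqP; apply/negP; exact: expi_neq1.
Qed.

Lemma resolvent_family : exists S : R[i] -> {linear V -> V},
  forall l, in_resolvent_set T l ->
    continuous (S l) /\ is_inverse (S l) (shift_op l T).
Proof.
suff /choice[S hS] : forall l, exists S : {linear V -> V},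
    in_resolvent_set T l -> continuous S /\ is_inverse S (shift_op l T) by exists S.
move=> l; have [[S hS]|nS] := pselect (in_resolvent_set T l); first by exists S.
(* An arbitrary default outside the resolvent set. *)
by exists T.
Qed.

(** Otherwise |exp(i t) - 1| m(t) <= t m(t) < 1, and perturbation from exp(i t) would put 1 in the
    resolvent set. *)
Lemma m_ge_inv t : 0 < t <= pi -> 1 <= t * m t.
Proof.
move=> ht; have /andP[t0 tp] := ht; rewrite leNgt; apply/negP => tm.
have ht' : 0 < `|t| <= pi by rewrite gtr0_norm.
have [S [cS iS]] := expi_resolvent ht'.
have S_le : forall x, nr (S x) <= m t * nr x.
  by have /op_norm_leP := m_res ht' iS; rewrite gtr0_norm.
have mt := m_gt0 ht.
have : (spectrum T `&` @unit_circle R) 1 by rewrite spT.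
case=> sp1 _; apply: sp1.
apply: resolvent_perturbation cS iS S_le _ (ltW mt).
apply: le_lt_trans tm; rewrite ler_wpM2r ?(ltW mt) //.
by have := nr_expi_sub1 t; rewrite gtr0_norm.
Qed.

End Resolvents.

(** * Choice of the parameters and final estimate *)

(** The sample angles run from pi / h to 2 pi - pi / h; those beyond pi are reduced by 2 pi, which
    leaves an angle of modulus at least pi / h >= t. *)
Lemma node_arc (R : realType) (h : nat) (t : R) (D : set R[i]) : (2 < h)%N ->
  t <= pi / h%:R ->
  (forall a : R, t <= `|a| <= pi -> D (expi a)) ->
  arc_in h.*2 D 1 (h.*2 - 1).
Proof.
move=> h3 th hD; split; first by lia.
move=> p j p0; rewrite muln1 => /andP[pj jp].
have hR0 : 0 < h%:R :> R by rewrite ltr0n; lia.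
have pR0 : 0 < p%:R :> R by rewrite ltr0n.
have pi0 : 0 < pi :> R by have := pi_ge2 R; lra.
rewrite root_exp //; set a := 2 * pi * _.
have aE : a = (j%:R / p%:R) * (pi / h%:R).
  by rewrite /a natrM -muln2 natrM; field; rewrite !gt_eqF.
have ph0 : 0 < pi / h%:R :> R by exact: divr_gt0.
have j1 : 1 <= j%:R / p%:R :> R by rewrite ler_pdivlMr // mul1r ler_nat.
have j2 : j%:R / p%:R <= 2 * h%:R - 1 :> R.
  rewrite ler_pdivrMr //; move: jp.
  rewrite mulnBr muln1 -(ler_nat R) natrB; last by rewrite leq_pmulr // double_gt0; lia.
  by rewrite natrM -mul2n natrM; lra.
have a1 : pi / h%:R <= a by rewrite aE ler_peMl // ltW.
have a2 : a <= 2 * pi - pi / h%:R.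
  rewrite aE; apply: le_trans (ler_wpM2r (ltW ph0) j2) _.
  by rewrite le_eqVlt; apply/orP; left; apply/eqP; field; rewrite gt_eqF.
have [ap|ap] := leP a pi.
  by apply: hD; rewrite ger0_norm; lra.
have -> : expi a = expi (a - 2 * pi).
  by rewrite -{1}(subrK (2 * pi) a) expiD expi2pi mulr1.
by apply: hD; rewrite ler0_norm; lra.
Qed.

(** The three summands of the constant come from the low part through 1 / L <= t / 2, from the
    corners through mu A / n^2 <= A / n <= A t, and from the last integral, where mu (4 + 2 d / n)
    <= 4 mu + 2 <= 5 mu. *)
Lemma rate_bound (R : realType) (c t mu M X n d L P : R) :
  0 < c < 1 -> 0 < t -> t <= 1 / 2 -> 0 < mu -> 1 <= t * mu -> mu <= n ->
  0 <= M -> 0 <= X -> L^-1 <= t / 2 -> 0 <= d -> d * mu <= n -> 0 <= P ->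
  P <= expR 2 * (t / mu) / (1 - c) ->
  M * (200 / L * X) + mu ^+ 1 * X *
    (5 / 2 / (1 - c) / (1 - c) / n ^+ 2 + (4 + 2 * d / n) * P) <=
  (100 * M + 5 / 2 / (1 - c) / (1 - c) + 5 * expR 2 / (1 - c)) * t * X.
Proof.
move=> /andP[c0 c1] t0 t2 mu0 tmu mun M0 X0 L_le dd0 dn P0 P_le.
have d0 : 0 < 1 - c by lra.
have n0 : 0 < n := lt_le_trans mu0 mun.
set A := 5 / 2 / (1 - c) / (1 - c).
have A0 : 0 <= A by rewrite /A !divr_ge0 // ltW.
have nV : n^-1 <= t.
  apply: le_trans (_ : mu^-1 <= _); first by rewrite lef_pV2 ?posrE.
  by rewrite -[mu^-1]mul1r ler_pdivrMr.
have A_le : mu * (A / n ^+ 2) <= A * t.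
  have -> : mu * (A / n ^+ 2) = A * ((mu / n) * n^-1) by field; rewrite gt_eqF.
  rewrite ler_wpM2l // -[t]mul1r; apply: ler_pM => //.
  - by rewrite divr_ge0 // ltW.
  - by rewrite invr_ge0 ltW.
  - by rewrite ler_pdivrMr // mul1r.
have kn : mu * (2 * d / n) <= 2.
  by rewrite mulrA ler_pdivrMr //; lra.
have mu2 : 2 <= mu.
  have : t * mu <= 1 / 2 * mu by rewrite ler_pM2r.
  lra.
have P_le2 : mu * ((4 + 2 * d / n) * P) <= 5 * expR 2 / (1 - c) * t.
  rewrite mulrA mulrDr; apply: le_trans (_ : (5 * mu) * P <= _).
    by rewrite ler_wpM2r //; lra.
  apply: le_trans (_ : (5 * mu) * (expR 2 * (t / mu) / (1 - c)) <= _).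
    by rewrite ler_wpM2l // mulr_ge0 // ltW.
  by rewrite le_eqVlt; apply/orP; left; apply/eqP; field; rewrite !gt_eqF.
have L_le2 : M * (200 / L) <= M * (100 * t) by rewrite ler_wpM2l //; lra.
set E := _ / n ^+ 2 + _; rewrite expr1.
have -> : M * (200 / L * X) + mu * X * E = (M * (200 / L) + mu * E) * X by ring.
rewrite ler_wpM2r // /E mulrDr; lra.
Qed.

Theorem theorem2p11 (R : realType) (V : completeNormedModType R[i])
    (T : {linear V -> V}) (m : R -> R) (c : R) :
  continuous T ->
  power_bounded T ->
  spectrum T `&` @unit_circle R = [set 1] ->
  {within `]0, pi], continuous m} ->
  (forall x y : R, 0 < x -> x <= y -> y <= pi -> m y <= m x) ->
  (forall t : R, 0 < t <= pi -> 0 < m t) ->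
  (forall t : R, 0 < `|t| <= pi ->
     forall S : V -> V, is_inverse S (shift_op (expi t) T) ->
       op_norm_le S (m `|t|)) ->
  0 < c < 1 ->
  exists K : R, exists N : nat, forall n : nat, (N <= n)%N ->
    exists t : R, [/\ 0 < t <= pi, m_log m t = c * n%:R &
      op_norm_le (fun x => iter n T (x - T x)) (K * t)].
Proof.
move=> _ [M' hM'] spT m_cont m_anti m_gt0 m_res /andP[c0 c1].
pose M := `|M'|; have M0 : 0 <= M by exact: normr_ge0.
have T_le k y : nr (iter k T y) <= M * nr y.
  have := hM' k y; rewrite -!nrE -rmorphM lecR => /le_trans; apply.
  by rewrite ler_wpM2r ?nr_ge0 // ler_norm.
have [S hS] := resolvent_family T.
(* Restricting to t <= exp(-1) ensures both t <= 1 / 2 and a logarithm of at least 1. *)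
pose b : R := expR (-1).
have b0 : 0 < b by exact: expR_gt0.
have pi2 := pi_ge2 R.
have b2 : b <= 1 / 2.
  by rewrite /b expRN div1r lef_pV2 ?posrE ?expR_gt0 //; have := expR_ge1Dx (1 : R); lra.
have bp : 0 < b <= pi by rewrite b0 /=; lra.
pose K := 100 * M + 5 / 2 / (1 - c) / (1 - c) + 5 * expR 2 / (1 - c).
exists K, (Num.truncn (m_log m b / c)).+1 => n hn.
have hw : m_log m b <= c * n%:R.
  rewrite mulrC -ler_pdivrMr //; apply: le_trans (ltW (truncnS_gt _)) _.
  by rewrite ler_nat.
have [t /andP[t0 tb] ht] := m_log_onto m_cont m_anti m_gt0 bp hw.
have tp : t <= pi by lra.
exists t; split=> //; first by rewrite t0.
apply/op_norm_leP => x.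
have -> : iter n T (x - T x) = - (iter n.+1 T x - iter n T x).
  rewrite opprB iterSr.
  by elim: {+}n => [|k ih] //=; rewrite ih linearB.
rewrite nrN.
pose mu := m t; have mu0 : 0 < mu by apply: m_gt0; rewrite t0.
have tmu : 1 <= t * mu by apply: (m_ge_inv spT m_gt0 m_res); rewrite t0.
(* The largest h with pi / h >= t, so that all nodes except 1 stay where the resolvent is bounded by
   [mu]. *)
pose h := Num.truncn (pi / t).
have pt0 : 0 <= pi / t by rewrite divr_ge0 ?pi_ge0 // ltW.
have /andP[h1 h2] := truncn_itv pt0; rewrite -/h in h1 h2.
have pt4 : 4 <= pi / t by rewrite ler_pdivlMr //; lra.
have h3 : (2 < h)%N.
  by rewrite -(ltr_nat R); move: h2; rewrite -natr1; lra.
have hR0 : 0 < h%:R :> R by rewrite ltr0n (ltn_trans _ h3).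
pose D := [set l | exists2 a : R, t <= `|a| <= pi & l = expi a].
have D_arc : arc_in h.*2 D 1 (h.*2 - 1).
  apply: (node_arc h3 (t := t)) => [|a ha]; last by exists a.
  by rewrite ler_pdivlMr // mulrC -ler_pdivlMr.
have Dres (a : R) : t <= `|a| <= pi -> 0 < `|a| <= pi.
  by case/andP=> ta ->; rewrite (lt_le_trans t0).
have D1 l : D l -> nr l = 1 by move=> [a _ ->]; exact: nr_expi.
have Dinv l : D l -> is_inverse (S l) (shift_op l T).
  move=> [a /Dres ha ->].
  by have [] := hS _ (expi_resolvent spT ha).
have SK l y : D l -> S l (l *: y - T y) = y by move=> /Dinv[h' _]; exact: h'.
have KS l y : D l -> l *: S l y - T (S l y) = y by move=> /Dinv[_ h']; exact: h'.
have S_le l y : D l -> nr (S l y) <= mu * nr y.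
  move=> Dl; have iS := Dinv _ Dl; case: Dl iS => a ha -> iS.
  have /op_norm_leP Sa := m_res _ (Dres _ ha) _ iS; apply: le_trans (Sa y) _.
  by rewrite ler_wpM2r ?nr_ge0 //; case/andP: ha => ta tpi; exact: m_anti.
pose q := mu / t; have q0 : 0 < q by exact: divr_gt0.
pose ell := ln (1 + q).
have nE : mu * ell = c * n%:R by exact: ht.
(* Indeed mu >= 1 / t >= e, so q = mu / t >= 1 / t >= e. *)
have ell1 : 1 <= ell.
  rewrite -ler_expR lnK ?posrE; last lra.
  have tV : expR 1 <= t^-1.
    by rewrite -[expR 1]invrK lef_pV2 ?posrE ?invr_gt0 ?expR_gt0 // -expRN.
  have muV : t^-1 <= mu by rewrite -[t^-1]mul1r ler_pdivrMr // mulrC.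
  have e1 : 1 <= expR (1 : R) by have := expR_ge1Dx (1 : R); lra.
  have : t^-1 * 1 <= q.
    rewrite /q; apply: ler_pM => //; rewrite ?invr_ge0 ?(ltW t0) //.
    exact: le_trans e1 tV.
  lra.
have n0 : (0 < n)%N by exact: leq_ltn_trans hn.
have nR0 : 0 < n%:R :> R by rewrite ltr0n.
have mun : mu <= n%:R.
  have : mu * 1 <= mu * ell by rewrite ler_pM2l.
  have : c * n%:R <= 1 * n%:R by rewrite ler_pM2r // ltW.
  lra.
(* The largest number of integrations by parts with kappa mu <= c n. *)
pose kappa := Num.truncn ell.
have ell0 : 0 <= ell by lra.
have /andP[k1 k2] := truncn_itv ell0; rewrite -/kappa in k1 k2.
have kappa0 : (0 < kappa)%N by rewrite /kappa truncn_gt0.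
have hk : kappa%:R * mu <= c * n%:R by rewrite -nE mulrC ler_pM2l.
have c01 : 0 <= c < 1 by rewrite c1 ltW.
have kd : (1 + kappa.-1 = kappa)%N by rewrite add1n prednK.
have hsum_le := hsum_decay h3 D1 (ltW mu0) SK KS S_le D_arc x n0 c01 hk kd (lexx n%:Z).
have := power_diff_le h3 D1 (ltW mu0) SK KS S_le D_arc M0 T_le hsum_le.
move=> /le_trans; apply.
have := @prod_natr_le R (mu / n%:R) c kappa.-1 c01.
set P := \prod_(i < kappa.-1) _ => hP.
have {hP} P_le : P <= expR (- kappa.-1%:R) / (1 - c).
  apply: hP; first by rewrite divr_ge0 // ltW.
  by rewrite prednK // mulrA ler_pdivrMr.
(* Rounding down and starting at k = 1 cost at most 2 in the exponent, and exp(- ell) = 1 / (1 + q)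
   <= t / mu. *)
have e_le : expR (- kappa.-1%:R) <= expR 2 * (t / mu).
  apply: le_trans (_ : expR (2 - ell) <= _).
    by rewrite ler_expR; move: k2; rewrite -{1}kd -natr1 natrD; lra.
  rewrite expRD ler_wpM2l ?expR_ge0 // expRN lnK ?posrE; last lra.
  have -> : t / mu = q^-1 by rewrite /q invf_div.
  by rewrite lef_pV2 ?posrE //; lra.
apply: rate_bound => //; rewrite ?nr_ge0 ?ler0n ?t0 //.
- by rewrite c0.
- exact: le_trans tb b2.
(* L = 2 h >= h + 1 > pi / t >= 2 / t. *)
- have : 1 <= h%:R :> R by rewrite ler1n (ltn_trans _ h3).
  have : 2 * t^-1 <= pi * t^-1 by rewrite ler_wpM2r // invr_ge0 ltW.
  rewrite -[t / 2]invrK lef_pV2 ?posrE ?invr_gt0 ?divr_gt0 ?ltr0n ?double_gt0 ?(ltn_trans _ h3) //.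
  by rewrite invf_div -mul2n natrM; move: h2; rewrite -natr1; lra.
- apply: le_trans (_ : kappa%:R * mu <= _).
    by rewrite ler_wpM2r ?(ltW mu0) // ler_nat leq_pred.
  by apply: le_trans hk _; rewrite ger_pMl // ltW.
- by apply: prodr_ge0 => i _; rewrite mulr_ge0 ?ler0n // divr_ge0 // ltW.
- apply: le_trans P_le _; rewrite ler_wpM2r // invr_ge0; lra.
Qed.
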